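(* There exists an absolute constant $C>0$ such that the following holds. Let $n,m\in\mathbb{N}$, $M\in\mathbb{R}$ with $M\ge\max(m,2)$, $A=(a_{ij})\in\mathbb{R}^{m\times n}$, and $\mathrm{imp}(i)\in\mathbb{R}_{\ge0}$ for each $i\in[m]$. There is a deterministic parallel algorithm with work $\tilde O(\mathrm{nnz}(A)+n+m)$ and depth $n\cdot\operatorname{poly}(\log M)$ that computes a vector $\chi\in\{-1,1\}^n$ such that, writing $\mathrm{disc}_i=\big|\sum_{j=1}^n a_{ij}\chi_j\big|$, $$\sum_{i=1}^m \mathrm{imp}(i)\,\mathrm{disc}_i^2\le\Big(1+\frac1M\Big)\sum_{i=1}^m\mathrm{imp}(i)\sum_{j=1}^n a_{ij}^2,$$ and moreover, for every $i\in[m]$, $\mathrm{disc}_i^2\le C\log M\cdot\sum_{j=1}^n a_{ij}^2$.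
   Context: Work-depth model of parallel computation: work is the total number of computational steps, depth is the longest chain of sequentially dependent steps. $\mathrm{nnz}(A)$ is the number of nonzero entries of $A$. $\tilde O(x)$ denotes $x$ times a polylogarithmic factor in $n,m,M$. *)

(* Defs.v *)
From HB Require Import structures.
From mathcomp Require Import all_boot all_order all_algebra.
From mathcomp Require Import boolp classical_sets reals exp.

Set Implicit Arguments.
Unset Strict Implicit.
Unset Printing Implicit Defensive.

Import Order.TTheory GRing.Theory Num.Theory.
Local Open Scope classical_set_scope.
Local Open Scope ring_scope.

(** * A work-depth model: real RAM with fork-join parallelism

    A program is a finite text, independent of the input.  Every thread has
    private integer and real registers; all threads share a memory made of
    numbered integer arrays and numbered real arrays.  Real arithmetic is exact
    and of unit cost, as usual for a real RAM.  To keep the unit-cost hypothesis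
    honest there is no rounding or conversion from reals to integers, the
    program constants are natural numbers, and integers (used for addressing)
    can only be added, subtracted and halved. *)

Inductive int_op := IAdd | ISub.
Inductive real_op := RAdd | RSub | RMul | RDiv.

Inductive guard :=
| ILt of nat & nat
| RLt of nat & nat.

(** Registers and arrays are referred to by number.  In [ILoad x a y] and
    [RLoad x a y], register [x] receives the cell of array [a] whose index is in
    integer register [y]; [IStore a y x] and [RStore a y x] are the converse
    assignments.  [Par x y c] runs, for each [i] less than the value of integer
    register [y], a thread executing [c] with [i] in its integer register
    [x]. *)
Inductive cmd :=
| Skip
| ISet of nat & nat
| IBin of int_op & nat & nat & nat
| IHalf of nat & nat
| RSet of nat & nat
| RBin of real_op & nat & nat & nat
| ILoad of nat & nat & nat
| IStore of nat & nat & nat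
| RLoad of nat & nat & nat
| RStore of nat & nat & nat
| Seq of cmd & cmd
| If of guard & cmd & cmd
| While of guard & cmd
| Par of nat & nat & cmd.

Definition upd (T : Type) (f : nat -> T) (x : nat) (v : T) : nat -> T :=
  fun y => if y == x then v else f y.

Definition eval_int (o : int_op) (x y : nat) : nat :=
  match o with IAdd => (x + y)%N | ISub => (x - y)%N end.

(** Division by zero returns zero; a program can test its divisors. *)
Definition eval_real (R : realType) (o : real_op) (x y : R) : R :=
  match o with
  | RAdd => x + y | RSub => x - y | RMul => x * y | RDiv => x / y
  end.

Record state (R : realType) := State {
  ireg : nat -> nat;
  rreg : nat -> R;
  imem : nat -> nat -> nat;
  rmem : nat -> nat -> R }.

Section Semantics.
Variable R : realType.
Implicit Types (s t : state R) (x y a : nat).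

Definition set_ireg s x (v : nat) :=
  State (upd (ireg s) x v) (rreg s) (imem s) (rmem s).
Definition set_rreg s x (v : R) :=
  State (ireg s) (upd (rreg s) x v) (imem s) (rmem s).
Definition set_imem s a (k : nat) (v : nat) :=
  State (ireg s) (rreg s) (upd (imem s) a (upd (imem s a) k v)) (rmem s).
Definition set_rmem s a (k : nat) (v : R) :=
  State (ireg s) (rreg s) (imem s) (upd (rmem s) a (upd (rmem s a) k v)).

Definition eval_guard s (g : guard) : bool :=
  match g with
  | ILt x y => (ireg s x < ireg s y)%N
  | RLt x y => rreg s x < rreg s y
  end.

(** Memory cells: [inl (a, k)] is cell [k] of integer array [a] and
    [inr (a, k)] is cell [k] of real array [a]. *)
Definition loc : Type := ((nat * nat) + (nat * nat))%type.

Record cost := Cost {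
  work : nat;
  depth : nat;
  reads : set loc;
  writes : set loc }.

Definition cost0 : cost := Cost 0 0 set0 set0.
Definition cost1 : cost := Cost 1 1 set0 set0.
Definition cost_read (l : loc) : cost := Cost 1 1 [set l] set0.
Definition cost_write (l : loc) : cost := Cost 1 1 set0 [set l].

Definition cost_seq (c d : cost) : cost :=
  Cost (work c + work d) (depth c + depth d)
       (reads c `|` reads d) (writes c `|` writes d).

Definition cost_par k (c : 'I_k -> cost) : cost :=
  Cost (\sum_(i < k) (work (c i)).+1).+1 (\max_(i < k) depth (c i)).+1
       [set l | exists i, reads (c i) l] [set l | exists i, writes (c i) l].

(** No cell written by a thread is accessed by another one, so that the outcome
    does not depend on how the threads are scheduled. *)
Definition race_free k (c : 'I_k -> cost) : Prop :=
  forall i j, i != j ->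
    writes (c i) `&` (reads (c j) `|` writes (c j)) = set0.

(** [s'] is the state after joining threads forked from [s] that ended in the
    states [t i] at the costs [c i]; their private registers are discarded. *)
Definition joined k s (t : 'I_k -> state R) (c : 'I_k -> cost) s' : Prop :=
  [/\ ireg s' = ireg s, rreg s' = rreg s,
      forall a x,
        (forall i, writes (c i) (inl (a, x)) ->
                   imem s' a x = imem (t i) a x) /\
        ((forall i, ~ writes (c i) (inl (a, x))) ->
                   imem s' a x = imem s a x)
    & forall a x,
        (forall i, writes (c i) (inr (a, x)) ->
                   rmem s' a x = rmem (t i) a x) /\
        ((forall i, ~ writes (c i) (inr (a, x))) ->
                   rmem s' a x = rmem s a x)].

Inductive exec : cmd -> state R -> state R -> cost -> Prop :=
| exec_skip s : exec Skip s s cost0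
| exec_iset s x v : exec (ISet x v) s (set_ireg s x v) cost1
| exec_ibin s o x y z :
    exec (IBin o x y z) s
      (set_ireg s x (eval_int o (ireg s y) (ireg s z))) cost1
| exec_ihalf s x y : exec (IHalf x y) s (set_ireg s x (ireg s y)./2) cost1
| exec_rset s x v : exec (RSet x v) s (set_rreg s x v%:R) cost1
| exec_rbin s o x y z :
    exec (RBin o x y z) s
      (set_rreg s x (eval_real o (rreg s y) (rreg s z))) cost1
| exec_iload s x a y :
    exec (ILoad x a y) s (set_ireg s x (imem s a (ireg s y)))
      (cost_read (inl (a, ireg s y)))
| exec_istore s a y x :
    exec (IStore a y x) s (set_imem s a (ireg s y) (ireg s x))
      (cost_write (inl (a, ireg s y)))
| exec_rload s x a y :
    exec (RLoad x a y) s (set_rreg s x (rmem s a (ireg s y)))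
      (cost_read (inr (a, ireg s y)))
| exec_rstore s a y x :
    exec (RStore a y x) s (set_rmem s a (ireg s y) (rreg s x))
      (cost_write (inr (a, ireg s y)))
| exec_seq c1 c2 s1 s2 s3 k1 k2 :
    exec c1 s1 s2 k1 -> exec c2 s2 s3 k2 ->
    exec (Seq c1 c2) s1 s3 (cost_seq k1 k2)
| exec_if g c1 c2 s s' k :
    exec (if eval_guard s g then c1 else c2) s s' k ->
    exec (If g c1 c2) s s' (cost_seq cost1 k)
| exec_while_done g c s : ~~ eval_guard s g -> exec (While g c) s s cost1
| exec_while_step g c s1 s2 s3 k1 k2 :
    eval_guard s1 g -> exec c s1 s2 k1 -> exec (While g c) s2 s3 k2 ->
    exec (While g c) s1 s3 (cost_seq cost1 (cost_seq k1 k2))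
| exec_par x y c s (t : 'I_(ireg s y) -> state R) (k : 'I_(ireg s y) -> cost)
    s' :
    (forall i : 'I_(ireg s y), exec c (set_ireg s x i) (t i) (k i)) ->
    race_free k -> joined s t k s' ->
    exec (Par x y c) s s' (cost_par k).

Lemma joined_inj k s (t : 'I_k -> state R) c s1 s2 :
  joined s t c s1 -> joined s t c s2 -> s1 = s2.
Proof.
case: s1 => i1 r1 m1 q1; case: s2 => i2 r2 m2 q2.
move=> [/= -> -> hm1 hq1] [/= -> -> hm2 hq2]; congr State.
- apply/funext => a; apply/funext => x.
  have [h1 n1] := hm1 a x; have [h2 n2] := hm2 a x.
  have [[i wi]|ni] := pselect (exists i, writes (c i) (inl (a, x))).
    by rewrite (h1 i wi) (h2 i wi).
  by rewrite n1 ?n2 // => i wi; apply: ni; exists i.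
- apply/funext => a; apply/funext => x.
  have [h1 n1] := hq1 a x; have [h2 n2] := hq2 a x.
  have [[i wi]|ni] := pselect (exists i, writes (c i) (inr (a, x))).
    by rewrite (h1 i wi) (h2 i wi).
  by rewrite n1 ?n2 // => i wi; apply: ni; exists i.
Qed.

Lemma exec_det c s s1 k1 s2 k2 :
  exec c s s1 k1 -> exec c s s2 k2 -> s1 = s2 /\ k1 = k2.
Proof.
move=> e1; elim: e1 s2 k2 => {c s s1 k1};
  try by [move=> *;
    match goal with H : exec _ _ _ _ |- _ => inversion H; subst; clear H end;
    repeat match goal with
    | IH : forall s k, exec ?c ?s0 s k -> _ /\ _, H : exec ?c ?s0 _ _ |- _ =>
        destruct (IH _ _ H); clear H; subst
    | H : is_true (~~ ?b), H' : is_true ?b |- _ => by rewrite H' in H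
    end].
move=> x y c s t k s' _ IH _ J s4 k4 H.
inversion H as [| | | | | | | | | | | | | |? ? ? ? t0 k0 ? E _ J0]; subst.
have et : t = t0 by apply/funext => i; have [] := IH i _ _ (E i).
have ek : k = k0 by apply/funext => i; have [] := IH i _ _ (E i).
by subst; split => //; apply: joined_inj J J0.
Qed.

End Semantics.

(** * Input and output conventions *)

Section IO.
Variables (R : realType) (m n : nat).
Implicit Types (A : 'M[R]_(m, n)) (imp : 'I_m -> R).

Definition nnz A : nat := #|[pred ij : 'I_m * 'I_n | A ij.1 ij.2 != 0]|.

(** The matrix is given in compressed sparse column format. *)
Definition col_rows A (j : 'I_n) : seq 'I_m :=
  [seq i <- enum 'I_m | A i j != 0].
Definition csc_ptr A (k : nat) : nat :=
  (\sum_(j < n | (j < k)%N) size (col_rows A j))%N.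
Definition csc_row A : seq nat :=
  flatten [seq [seq val i | i <- col_rows A j] | j <- enum 'I_n].
Definition csc_val A : seq R :=
  flatten [seq [seq A i j | i <- col_rows A j] | j <- enum 'I_n].

Definition input (M : R) A imp : state R :=
  State
    (nth 0%N [:: n; m])
    (nth 0 [:: M])
    (fun a => match a with
              | 0 => csc_ptr A
              | 1 => nth 0%N (csc_row A)
              | _ => fun=> 0%N end)
    (fun a => match a with
              | 0 => nth 0 (csc_val A)
              | 1 => fun k => oapp imp 0 (insub k)
              | _ => fun=> 0 end).

Definition output (s : state R) (j : 'I_n) : R := rmem s 2 j.

Definition disc A (chi : 'I_n -> R) (i : 'I_m) : R :=
  `|\sum_(j < n) A i j * chi j|.

End IO.

(* Main.v *)
Require Import Defs.
From HB Require Import structures.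
From mathcomp Require Import all_boot all_order all_algebra.
From mathcomp Require Import boolp classical_sets reals sequences exp.
From mathcomp Require Import zify ring lra.

Set Implicit Arguments.
Unset Strict Implicit.
Unset Printing Implicit Defensive.

Import Order.TTheory GRing.Theory Num.Theory.
Local Open Scope ring_scope.

(** The signs are chosen one column at a time so as not to increase a potential.
    Normalise the importances to total weight one, and let row [i] have the scale
    [rho_i], within a factor two of [sqrt (sg_i / L)], where [sg_i] is the sum of
    the squares of the row and [L] is about [log2 M].  With
    [b_ij = a_ij / rho_i], replaced by [0] when it exceeds [1/2] in absolute
    value, the potential is the sum over the rows of
      [w_i (d_i ^ 2 - sum_j a_ij ^ 2)
       + delta (prod_j (1 + b_ij chi_j) + prod_j (1 - b_ij chi_j))],
    the inner sums and products ranging over the columns already signed.  It is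
    affine in the next sign, so some sign does not increase it, and the field
    operations of the machine compute the slope exactly.  As the products are
    nonnegative and [delta = 1 / (2 M ^ 2)], its final value bounds the weighted
    discrepancy, and also each product by [4 M ^ 2].  From
    [1 + y >= exp (y - 2 y ^ 2)] for [y >= -1/2] the unclipped part of each
    [d_i] is [O(L rho_i)], and so is the sum of the clipped entries.

    The rows of a column are processed in parallel, and a column is summed by
    repeated folding, in depth [O(log m)].  The scale [rho_i] is found by halving
    the sum of the absolute values of the row, which exceeds [sqrt sg_i] by a
    factor at most [sqrt n]. *)

(** * Cost-aware total correctness *)

Section Logic.
Variable R : realType.
Implicit Types (s t : state R) (rd wr : nat -> nat -> Prop).

(** Integer memory is never written, so reads of it cannot race and only the real cells need
    tracking. *)
Definition foot rd wr (k : cost) : Prop :=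
  [/\ forall a x, reads k (inr (a, x)) -> rd a x,
      forall a x, writes k (inr (a, x)) -> wr a x
    & forall a x, ~ writes k (inl (a, x))].

(** A weakest precondition with upper bounds on the costs. The existential final state loses
    nothing, as execution is deterministic ([exec_det]). *)
Definition runs rd wr (c : cmd) s (w d : nat) (Q : state R -> Prop) : Prop :=
  exists s' k, [/\ exec c s s' k, (work k <= w)%N, (depth k <= d)%N,
                   foot rd wr k & Q s'].

Definition seqs (cs : seq cmd) : cmd := foldr Seq Skip cs.

Definition atom (c : cmd) : bool :=
  match c with
  | IStore _ _ _ | Seq _ _ | If _ _ _ | While _ _ | Par _ _ _ => false
  | _ => true
  end.

Definition step (c : cmd) s : state R :=
  match c with
  | ISet x v => set_ireg s x v
  | IBin o x y z => set_ireg s x (eval_int o (ireg s y) (ireg s z))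
  | IHalf x y => set_ireg s x (ireg s y)./2
  | RSet x v => set_rreg s x v%:R
  | RBin o x y z => set_rreg s x (eval_real o (rreg s y) (rreg s z))
  | ILoad x a y => set_ireg s x (imem s a (ireg s y))
  | RLoad x a y => set_rreg s x (rmem s a (ireg s y))
  | RStore a y x => set_rmem s a (ireg s y) (rreg s x)
  | _ => s
  end.

Definition allowed rd wr (c : cmd) s : Prop :=
  match c with
  | RLoad _ a y => rd a (ireg s y)
  | RStore a y _ => wr a (ireg s y)
  | _ => True
  end.

Lemma foot_seq rd wr k1 k2 :
  foot rd wr k1 -> foot rd wr k2 -> foot rd wr (cost_seq k1 k2).
Proof.
move=> [r1 w1 i1] [r2 w2 i2]; split=> a x /=.
- by case=> [/r1|/r2].
- by case=> [/w1|/w2].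
- by case=> [/i1|/i2].
Qed.

Lemma foot0 rd wr w d :
  foot rd wr (Cost w d classical_sets.set0 classical_sets.set0).
Proof. by split=> a x []. Qed.

Lemma runs_skip rd wr s w d Q : Q s -> runs rd wr Skip s w d Q.
Proof. by move=> q; exists s, cost0; split=> //; [exact: exec_skip | exact: foot0]. Qed.

Lemma runs_weaken rd wr c s w d w' d' Q :
  (w' <= w)%N -> (d' <= d)%N -> runs rd wr c s w' d' Q -> runs rd wr c s w d Q.
Proof.
move=> lw ld [s' [k [e hw hd hf q]]]; exists s', k; split=> //.
- exact: leq_trans lw.
- exact: leq_trans ld.
Qed.

Lemma runs_post rd wr c s w d Q Q' :
  (forall t, Q t -> Q' t) -> runs rd wr c s w d Q -> runs rd wr c s w d Q'.
Proof. by move=> qq [s' [k [e hw hd hf /qq q]]]; exists s', k. Qed.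

Lemma runs_seq rd wr c1 c2 s w1 d1 w2 d2 Q :
  runs rd wr c1 s w1 d1 (fun t => runs rd wr c2 t w2 d2 Q) ->
  runs rd wr (Seq c1 c2) s (w1 + w2) (d1 + d2) Q.
Proof.
move=> [s1 [k1 [e1 hw1 hd1 f1 [s2 [k2 [e2 hw2 hd2 f2 q]]]]]].
exists s2, (cost_seq k1 k2); split=> //=.
- exact: exec_seq e1 e2.
- exact: leq_add.
- exact: leq_add.
- exact: foot_seq.
Qed.

Lemma runs_cons rd wr c cs s w1 d1 w2 d2 Q :
  runs rd wr c s w1 d1 (fun t => runs rd wr (seqs cs) t w2 d2 Q) ->
  runs rd wr (seqs (c :: cs)) s (w1 + w2) (d1 + d2) Q.
Proof. exact: runs_seq. Qed.

Lemma runs_atom rd wr c cs s w d Q :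
  atom c -> allowed rd wr c s -> runs rd wr (seqs cs) (step c s) w d Q ->
  runs rd wr (seqs (c :: cs)) s w.+1 d.+1 Q.
Proof.
move=> ac al h; apply: (@runs_seq _ _ c (seqs cs) _ 1 1).
case: c ac al h => //= [_ _|x v _ _|o x y z _ _|x y _ _|x v _ _|o x y z _ _
  |x a y _ _|x a y _ al|a y x _ al] h; eexists; eexists;
  (split; [by constructor | by [] | by [] | | exact: h]); try exact: foot0.
- by split=> b z [].
- by split=> b z // -[-> ->].
- by split=> b z // -[-> ->].
Qed.

(** The hypothesis runs the chosen branch together with the continuation, so that no intermediate
    assertion is needed where they meet. *)
Lemma runs_if rd wr g c1 c2 cs s w d Q :
  runs rd wr (seqs ((if eval_guard s g then c1 else c2) :: cs)) s w d Q ->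
  runs rd wr (seqs (If g c1 c2 :: cs)) s w.+1 d.+1 Q.
Proof.
move=> [s' [k [e hw hd hf q]]].
inversion e as [| | | | | | | | | |? ? ? s2 ? k1 k2 e1 e2| | | |]; subst.
exists s', (cost_seq (cost_seq cost1 k1) k2); split=> //=.
- by apply: exec_seq e2; apply: exec_if.
- by case: hf => h1 h2 h3; split=> a x h; [apply: (h1 a x)|apply: (h2 a x)|apply: (h3 a x)];
  case: h => [[[]|]|]; by [left | right].
Qed.

(** The number [k] bounds the iterations left. The work of an iteration may depend on it, because
    columns differ in length; for the depth a uniform bound suffices. *)
Lemma runs_while rd wr g c s (w : nat -> nat) d (Inv : nat -> state R -> Prop) Q
  k :
  (forall k s, Inv k s -> eval_guard s g ->
     (0 < k)%N /\ runs rd wr c s (w k) d (Inv k.-1)) ->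
  (forall k s, Inv k s -> ~~ eval_guard s g -> Q s) ->
  Inv k s ->
  runs rd wr (While g c) s (\sum_(i < k) (w i.+1).+1).+1 (k * d.+1).+1 Q.
Proof.
move=> hc hq; elim: k s => [|k IH] s inv.
  have [gs|gs] := boolP (eval_guard s g).
    by have [] := hc _ _ inv gs.
  exists s, cost1; split=> //; [exact: exec_while_done | exact: foot0 |].
  exact: hq inv gs.
have [gs|gs] := boolP (eval_guard s g); last first.
  exists s, cost1; split=> //; [exact: exec_while_done | exact: foot0 |].
  exact: hq inv gs.
have [_ [s1 [k1 [e1 hw1 hd1 f1 /= inv1]]]] := hc _ _ inv gs.
have [s2 [k2 [e2 hw2 hd2 f2 q]]] := IH _ inv1.
exists s2, (cost_seq cost1 (cost_seq k1 k2)); split=> //=.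
- exact: exec_while_step e1 e2.
- rewrite big_ord_recr /= add1n ltnS addnS addnC.
  by apply: leq_trans (leq_add hw2 hw1) _; rewrite addSn.
- by rewrite add1n mulSn addSn ltnS -addnS leq_add.
- by apply: foot_seq; [exact: foot0 | exact: foot_seq].
Qed.

(** In [runs_par], this recovers the initial content of a private cell that its owner leaves
    unwritten. *)
Lemma exec_frame c s s' k a x : exec c s s' k ->
  ~ writes k (inr (a, x)) -> rmem s' a x = rmem s a x.
Proof.
elim=> {c s s' k} //=.
- move=> s b y z h; rewrite /upd; case: eqP => // e; case: eqP => [e'|_]; last by rewrite e.
  by case: h; rewrite e e'.
- by move=> c1 c2 s1 s2 s3 k1 k2 _ h1 _ h2 h; rewrite h2 ?h1 // => h'; apply: h; auto.
- by move=> g c1 c2 s s' k _ h1 h; apply: h1 => h'; apply: h; right.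
- move=> g c s1 s2 s3 k1 k2 _ _ h1 _ h2 h; rewrite h2 ?h1 // => h'; apply: h;
  right; by auto.
- move=> z y c s t k s' _ _ _ [_ _ _ /(_ a x)[_ j]] h; apply: j => i hi.
  by apply: h; exists i.
Qed.

(* [Priv i] are the cells private to thread [i]; all threads may read [Sh]. *)
Lemma runs_par rd wr x y c s w d (Priv : nat -> nat -> nat -> Prop) Sh
    (Qi : nat -> (nat -> nat -> R) -> Prop) (Q : state R -> Prop) :
  let N := ireg s y in
  (forall i, (i < N)%N ->
     runs (fun a z => Priv i a z \/ Sh a z) (Priv i) c (set_ireg s x i) w d
       (fun t => Qi i (rmem t))) ->
  (forall i j a z, (i < N)%N -> (j < N)%N -> Priv i a z -> Priv j a z ->
     i = j) ->
  (forall i a z, (i < N)%N -> Priv i a z -> Sh a z -> False) ->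
  (forall i a z, (i < N)%N -> Priv i a z \/ Sh a z -> rd a z) ->
  (forall i a z, (i < N)%N -> Priv i a z -> wr a z) ->
  (forall f : nat -> nat -> R,
     (forall i, (i < N)%N -> exists g, Qi i g /\
        forall a z, Priv i a z -> f a z = g a z) ->
     (forall a z, (forall i, (i < N)%N -> ~ Priv i a z) -> f a z = rmem s a z) ->
     Q (State (ireg s) (rreg s) (imem s) f)) ->
  runs rd wr (Par x y c) s (N * w.+1).+1 d.+1 Q.
Proof.
move=> N hi hdis hsh hrd hwr hQ.
have /choice[tk htk] : forall i : 'I_N, exists tk : state R * cost,
    [/\ exec c (set_ireg s x i) tk.1 tk.2, (work tk.2 <= w)%N,
        (depth tk.2 <= d)%N,
        foot (fun a z => Priv i a z \/ Sh a z) (Priv i) tk.2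
      & Qi i (rmem tk.1)].
  by move=> i; have [t [k h]] := hi i (ltn_ord i); exists (t, k).
pose t i := (tk i).1; pose k i := (tk i).2.
(* The joined memory takes each private cell from its owner, unique by disjointness, and all other
   cells from the initial state. *)
pose f a z := match pselect (exists i : 'I_N, Priv i a z) with
              | left e => rmem (t (projT1 (cid e))) a z
              | right _ => rmem s a z end.
have fi (i : 'I_N) a z : Priv i a z -> f a z = rmem (t i) a z.
  move=> p; rewrite /f; case: pselect => [e|]; last by case; exists i.
  case: (cid e) => j /= pj; congr (rmem (t _) _ _); apply: val_inj.
  exact: hdis pj p.
have f0 a z : (forall i : 'I_N, ~ Priv i a z) -> f a z = rmem s a z.
  by move=> h; rewrite /f; case: pselect => // -[i pi]; case: (h i pi).
have race : race_free k.
  move=> i j nij; apply/classical_sets.seteqP; split=> // -[] [a z] [].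
    by have [_ _ _ [_ _ h] _] := htk i; move=> hw; case: (h _ _ hw).
  have [_ _ _ [_ wi _] _] := htk i; have [_ _ _ [rj wj _] _] := htk j.
  move=> /wi pi [/rj[pj|/(hsh _ _ _ (ltn_ord i) pi)//]|/wj pj].
    by case/eqP: nij; apply: val_inj; apply: hdis pi pj.
  by case/eqP: nij; apply: val_inj; apply: hdis pi pj.
exists (State (ireg s) (rreg s) (imem s) f), (cost_par k); split.
- apply: (exec_par (t := t)) => //; first by move=> i; have [] := htk i.
  split=> //= a z; split.
  + by move=> i; have [_ _ _ [_ _ h] _] := htk i; move=> /h.
  + by [].
  + by move=> i; have [_ _ _ [_ h _] _] := htk i; move=> /h; apply: fi.
  + move=> nw; have [[i pi]|np] := pselect (exists i : 'I_N, Priv i a z).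
      rewrite (fi _ _ _ pi); have [e _ _ _ _] := htk i.
      by rewrite (exec_frame e (nw i)).
    by apply: f0 => i pi; apply: np; exists i.
- rewrite /= ltnS; apply: leq_trans (_ : (\sum_(i < N) w.+1 <= _)%N).
    by apply: leq_sum => i _; have [] := htk i.
  by rewrite sum_nat_const card_ord.
- by rewrite /= ltnS; apply/bigmax_leqP => i _; have [] := htk i.
- split=> a z [i].
  + by have [_ _ _ [h _ _] _] := htk i; move=> /h; apply: hrd.
  + by have [_ _ _ [_ h _] _] := htk i; move=> /h; apply: hwr.
  + by have [_ _ _ [_ _ h] _] := htk i; move=> /h.
- apply: hQ => [i li|a z h]; last by apply: f0 => i; apply: h.
  exists (rmem (t (Ordinal li))); split; first by have [] := htk (Ordinal li).
  by move=> a z p; apply: (fi (Ordinal li)).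
Qed.

End Logic.

Arguments seqs : simpl never.

(** * Parallel summation *)

(** A round adds the last [l./2] live cells onto the first ones and keeps [l - l./2] cells, so the
    middle cell of an odd length is not touched. The final test returns 0 for an empty buffer. *)
Definition reduce : cmd := seqs
  [:: ISet 12 0; IBin IAdd 9 5 12;
      While (ILt 2 9) (seqs
        [:: IHalf 10 9; IBin ISub 11 9 10;
            Par 6 10 (seqs
              [:: IBin IAdd 7 6 11; RLoad 5 5 6; RLoad 6 5 7; RBin RAdd 5 5 6;
                  RStore 5 6 5]);
            IBin ISub 9 9 10]);
      RSet 5 0; If (ILt 12 5) (RLoad 5 5 12) Skip].

Section Reduce.
Variable R : realType.
Implicit Types s t : state R.

Definition any_cell (a x : nat) := True.

Definition same_context s t : Prop :=
  [/\ imem t = imem s, forall x, (x < 6)%N -> ireg t x = ireg s x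
    & forall x, (x < 5)%N -> rreg t x = rreg s x].

Lemma upd_lt (T : Type) (f : nat -> T) x v y N :
  (y < N)%N -> (N <= x)%N -> upd f x v y = f y.
Proof. by move=> yN Nx; rewrite /upd ltn_eqF // (leq_trans yN Nx). Qed.

(** This is the invariance of the sum under one round of [reduce]. *)
Lemma sum_fold_half (f : nat -> R) l :
  \sum_(i < l - l./2) (if (i < l./2)%N then f i + f (i + (l - l./2))%N else f i)
  = \sum_(i < l) f i.
Proof.
set h := l./2; have hl : (h <= l - h)%N by rewrite /h; lia.
rewrite -(big_mkord xpredT f) (big_cat_nat (n := (l - h)%N)) //=; last by lia.
have -> : \sum_(l - h <= i < l) f i = \sum_(0 <= i < h) f (i + (l - h))%N.
  by rewrite -{1}[(l - h)%N]add0n big_addn subKn // /h; lia.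
rewrite -(big_mkord xpredT (fun i =>
  if (i < h)%N then f i + f (i + (l - h))%N else f i)).
rewrite (big_cat_nat (n := h)) //= [X in _ = X + _](big_cat_nat (n := h)) //=.
rewrite addrAC.
congr (_ + _).
  rewrite -big_split /=; apply: eq_big_nat => i /andP[_ ->] //.
by apply: eq_big_nat => i /andP[hi _]; rewrite ltnNge hi.
Qed.

Lemma runs_reduce s K :
  ireg s 2 = 1%N -> (ireg s 5 <= 2 ^ K)%N ->
  runs any_cell any_cell reduce s (K * (6 * ireg s 5 + 5) + 10) (K * 12 + 10)
    (fun t => [/\ same_context s t, forall a, a != 5%N -> rmem t a = rmem s a
                & rreg t 5 = \sum_(i < ireg s 5) rmem s 5 i]).
Proof.
move=> h2 hK; rewrite /reduce.
(* Here and below, the budget is restated in the form that the rules consume command by command. *)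
apply: (runs_weaken (w' := ((K * (6 * ireg s 5 + 5)).+1 + 4).+2)
                    (d' := ((K * 12).+1 + 4).+2)); [lia..|].
do 2! (apply: runs_atom => //=).
apply: runs_cons.
pose len := ireg s 5.

apply: (runs_post (Q := fun t => [/\ same_context s t, ireg t 12 = 0%N,
    forall a, a != 5%N -> rmem t a = rmem s a,
    (0 < len)%N -> ireg t 9 = 1%N & \sum_(i < ireg t 9) rmem t 5 i = \sum_(i < len) rmem s 5 i])).
  move=> t [[hi hr hq] h12 hm h9 hs].
  apply: runs_atom => //=; apply: runs_if => /=.
  rewrite /upd /= h12 hr //; case: ltnP => hl.
    apply: runs_atom => //; apply: runs_skip => /=; split=> //.
      by split=> // x hx /=; rewrite !(upd_lt _ _ hx) // hq.
    by rewrite /upd /= h12 -/len -hs h9 // big_ord1.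
  apply: runs_atom => //; apply: runs_skip => /=; split=> //.
    by split=> // x hx /=; rewrite !(upd_lt _ _ hx) // hq.
  by rewrite /upd /=; move: hl; rewrite leqn0 => /eqP ->; rewrite big_ord0.
(* The live length is compared with [2 ^ k], because halving with rounding up respects powers of
   two. *)
pose Inv k t := [/\ same_context s t, ireg t 12 = 0%N,
    forall a, a != 5%N -> rmem t a = rmem s a,
    [/\ (0 < len)%N -> (0 < ireg t 9)%N, (ireg t 9 <= len)%N & (ireg t 9 <= 2 ^ k)%N]
  & \sum_(i < ireg t 9) rmem t 5 i = \sum_(i < len) rmem s 5 i].
apply: (runs_weaken (w' := (\sum_(i < K) (6 * len + 4).+1).+1) (d' := (K * 12).+1)) => //.
  by rewrite sum_nat_const card_ord -addnS.
(* Every round is charged the full initial length although the live part shrinks; this costs only a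
   logarithmic factor. *)
apply: (runs_while (w := fun=> (6 * len + 4)%N) (Inv := Inv)); last first.
- split=> //=; rewrite /upd /= ?addn0 //.
  split=> // x hx /=; by rewrite !(upd_lt _ _ hx).
- move=> k t [st h12 hm [h9 h9l _] hs] /=; case: (st) => _ -> // _.
  by rewrite h2 -leqNgt => hle; split=> // /h9 h; lia.
move=> k t [st h12 hm [h9 h9l h9k] hs] /=; case: (st) => hi hr hq.
rewrite hr // h2 => hlt; split.
  by case: k h9k => //; rewrite expn0 leqNgt hlt.
set l := ireg t 9.
apply: (runs_weaken (w' := ((l./2 * 6).+1 + 1).+2) (d' := (6 + 1).+2)).
- by move: h9l; rewrite -/l; lia.
- by [].
do 2! (apply: runs_atom => //=).
apply: runs_cons; rewrite /upd /=.
have Nl : ireg (set_ireg (set_ireg t 10 l./2) 11 (l - l./2)) 10 = l./2 by [].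
rewrite -/l -{3}Nl.
(* Thread [i] owns both the cell that it updates and the cell that it folds in, so nothing is
   shared. *)
apply: (@runs_par _ _ _ _ _ _ _ 5 5
  (fun i a z => a = 5%N /\ (z = i \/ z = (i + (l - l./2))%N)) (fun _ _ => False)
  (fun i g => g 5%N i = rmem t 5 i + rmem t 5 (i + (l - l./2))%N)); rewrite Nl //.
- move=> i il; rewrite /upd /=.
  do 5! (apply: runs_atom => //=; auto).
  by apply: runs_skip; rewrite /= /upd /= eqxx.
- by move=> i j a z il jl [_ h] [_ h']; lia.
move=> f hf1 hf2; rewrite /=; apply: runs_atom => //.
apply: runs_skip => /=; split=> //=.
- by split=> // x hx /=; rewrite !(upd_lt _ _ hx) // ?hr ?hq.
- move=> a /eqP ha; rewrite -hm; last exact/eqP.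
  by apply/funext => z; apply: hf2 => i _ [].
- rewrite /upd /=; split.
  + by move=> _; lia.
  + by move: h9l; rewrite -/l; lia.
  + move: h9k; rewrite -/l; case: k {h9l} => [|k]; first by move: hlt; rewrite -/l expn0; lia.
    by rewrite expnS /=; lia.
rewrite /upd /= -hs -/l -sum_fold_half; apply: eq_bigr => i _.
case: ltnP => il; last first.
  by apply: hf2 => j jl [_ hj]; have := ltn_ord i; lia.
by have [g [<- ->]] := hf1 i il; auto.
Qed.

End Reduce.

(** * The program *)

(* Integer registers: 2 holds the constant 1, 3 the current column, 4 and 5 its
   offset and length, 6 the thread number.  Real registers: 1 holds the constant
   1, 2 the integer [L] with [2 ^ (L - 1) < M <= 2 ^ L], 3 the total weight, 4
   the factor [delta].  Real arrays: 3 and 4 hold the sums of squares and of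
   absolute values of the rows, 5 is the summation buffer, 6 the scales
   [1 / rho], 7 the signed row sums, 8 and 9 the two products of the potential. *)

Definition column_cell : seq cmd :=
  [:: IBin IAdd 7 4 6; RLoad 5 0 7; ILoad 8 1 7].

Definition row_stats : cmd := seqs (column_cell ++
  [:: RLoad 6 3 8; RBin RMul 7 5 5; RBin RAdd 6 6 7; RStore 3 8 6;
      RLoad 6 1 8; RBin RMul 6 6 7; RStore 5 6 6;
      RSet 7 0; If (RLt 5 7) (RBin RSub 5 7 5) Skip;
      RLoad 6 4 8; RBin RAdd 6 6 5; RStore 4 8 6]).

(** The test [1 < 4 c ^ 2] detects [|c| > 1/2] without computing an absolute value. *)
Definition clipped_cell : seq cmd := column_cell ++
  [:: RLoad 7 6 8; RBin RMul 7 7 5;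
      RBin RMul 8 7 7; RBin RAdd 8 8 8; RBin RAdd 8 8 8;
      If (RLt 1 8) (RSet 7 0) Skip].

(** The contribution of one row to the coefficient of the new sign in the potential, namely
    [(p - q) b delta + 2 w a d]. *)
Definition potential_slope : cmd := seqs (clipped_cell ++
  [:: RLoad 8 8 8; RLoad 9 9 8; RBin RSub 8 8 9; RBin RMul 8 8 7;
      RBin RMul 8 8 4;
      RLoad 9 1 8; RBin RDiv 9 9 3; RBin RMul 9 9 5; RLoad 10 7 8;
      RBin RMul 9 9 10; RBin RAdd 9 9 9; RBin RAdd 8 8 9; RStore 5 6 8]).

Definition row_update : cmd := seqs (clipped_cell ++
  [:: RBin RMul 5 5 6; RBin RMul 7 7 6;
      RLoad 8 7 8; RBin RAdd 8 8 5; RStore 7 8 8;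
      RLoad 8 8 8; RBin RAdd 9 1 7; RBin RMul 8 8 9; RStore 8 8 8;
      RLoad 8 9 8; RBin RSub 9 1 7; RBin RMul 8 8 9; RStore 9 8 8]).

Definition load_column : seq cmd :=
  [:: ILoad 4 0 3; IBin IAdd 7 3 2; ILoad 5 0 7; IBin ISub 5 5 4].

Definition stats_pass : cmd := seqs (load_column ++
  [:: Par 6 5 row_stats; reduce; RBin RAdd 3 3 5; IBin IAdd 3 3 2]).

(** The machine has no square roots, so halving starts from the sum of absolute values and only
    squares are compared. The two products of the row are initialised here as well. *)
Definition scale_row : cmd := seqs
  [:: RLoad 5 3 6; RLoad 6 4 6; RSet 8 2; RBin RMul 7 6 6; RBin RMul 7 7 2;
      While (RLt 5 7) (seqs
        [:: RBin RDiv 6 6 8; RBin RMul 7 6 6; RBin RMul 7 7 2]);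
      RBin RDiv 6 1 6; RStore 6 6 6; RStore 8 6 1; RStore 9 6 1].

Definition sign_pass : cmd := seqs (load_column ++
  [:: Par 6 5 potential_slope; reduce;
      RSet 7 0; If (RLt 7 5) (RBin RSub 6 7 1) (RBin RAdd 6 7 1);
      RStore 2 3 6; Par 6 5 row_update; IBin IAdd 3 3 2]).

Definition balance : cmd := seqs
  [:: RSet 1 1; RSet 2 0; RSet 5 1;
      While (RLt 5 0) (seqs [:: RBin RAdd 5 5 5; RBin RAdd 2 2 1]);
      ISet 2 1; ISet 3 0; RSet 3 0;
      While (ILt 3 0) stats_pass;
      Par 6 1 scale_row;
      RBin RMul 5 0 0; RBin RAdd 5 5 5; RBin RDiv 4 1 5;
      ISet 3 0;
      While (ILt 3 0) sign_pass].

(** * Correctness and cost of the passes over the columns *)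

Section Columns.
Variables (R : realType) (n m : nat) (M : R).
Variables (av : nat -> nat -> R) (iv : nat -> R).
Variables (cptr crow : nat -> nat) (cval : nat -> R).

Definition support_rows (j : nat) : seq nat := [seq x <- iota 0 m | av x j != 0].

Hypothesis av0 : forall x j, (m <= x)%N -> av x j = 0.
Hypothesis cptrS : forall j, (j < n)%N -> cptr j.+1 = (cptr j + size (support_rows j))%N.
Hypothesis crowE : forall j i, (j < n)%N -> (i < size (support_rows j))%N ->
  crow (cptr j + i)%N = nth 0%N (support_rows j) i.
Hypothesis cvalE : forall j i, (j < n)%N -> (i < size (support_rows j))%N ->
  cval (cptr j + i)%N = av (nth 0%N (support_rows j) i) j.

Implicit Types s t : state R.

Lemma size_support_rows j : (size (support_rows j) <= m)%N.
Proof. by rewrite size_filter (leq_trans (count_size _ _)) ?size_iota. Qed.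

Lemma mem_support_rows j x : (x \in support_rows j) = (av x j != 0).
Proof.
rewrite mem_filter mem_iota add0n /=; case: eqP => //= /eqP h.
by rewrite ltnNge; apply: contra h => /av0 ->.
Qed.

(** Turns a sum over the buffer, with one cell per nonzero entry, into a sum over all rows. *)
Lemma sum_support_rows j (g : nat -> R) : (forall x, av x j = 0 -> g x = 0) ->
  \sum_(i < size (support_rows j)) g (nth 0%N (support_rows j) i) = \sum_(x < m) g x.
Proof.
move=> g0; rewrite -(big_mkord xpredT (fun i => g (nth 0%N (support_rows j) i))).
rewrite -(big_nth 0%N xpredT g) big_filter.
rewrite -(big_mkord xpredT g) big_mkcond /= /index_iota subn0.
by apply: eq_bigr => x _; case: eqP => //= /g0 ->.
Qed.

Definition row_array (a : nat) : bool := a \in [:: 1; 3; 4; 6; 7; 8; 9]%N.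

Lemma row_array_ind (P : nat -> Prop) : P 1%N -> P 3%N -> P 4%N -> P 6%N -> P 7%N ->
  P 8%N -> P 9%N -> forall a, row_array a -> P a.
Proof. by move=> p1 p3 p4 p6 p7 p8 p9; do 10! case=> [|] //. Qed.

(** A thread owns the cells of its row even in arrays that it only reads, and one cell of the
    buffer. The rows occurring in a column are distinct, so ownership is disjoint. *)
Definition private_cell (i r a z : nat) : Prop :=
  (row_array a /\ z = r) \/ (a = 5%N /\ z = i).

Ltac owned :=
  first [exact: I | by split | by left; split | by left; left | by left; right | by left | by right].

(** Each [F a] describes a whole array after the join, so it must agree with the old contents at the
    rows absent from the column. *)
Lemma runs_col s j body w d (F : nat -> nat -> R) (G : nat -> R) Q :
  ireg s 5 = size (support_rows j) ->
  (forall i, (i < size (support_rows j))%N -> let r := nth 0%N (support_rows j) i in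
     runs (fun a z => private_cell i r a z \/ a = 0%N) (private_cell i r) body
       (set_ireg s 6 i) w d
       (fun t => (forall a, row_array a -> rmem t a r = F a r) /\
                 rmem t 5 i = G i)) ->
  (forall a z, row_array a -> av z j = 0 -> F a z = rmem s a z) ->
  (forall f : nat -> nat -> R, (forall a, row_array a -> f a = F a) ->
     f 0%N = rmem s 0%N -> f 2%N = rmem s 2%N ->
     (forall i, (i < size (support_rows j))%N -> f 5%N i = G i) ->
     Q (State (ireg s) (rreg s) (imem s) f)) ->
  runs any_cell any_cell (Par 6 5 body) s (size (support_rows j) * w.+1).+1 d.+1 Q.
Proof.
move=> h5 hb hF hQ; rewrite -{1}h5.
have un : uniq (support_rows j) by rewrite filter_uniq ?iota_uniq.
apply: (@runs_par _ _ _ _ _ _ _ w d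
  (fun i a z => private_cell i (nth 0%N (support_rows j) i) a z) (fun a _ => a = 0%N)
  (fun i g => (forall a, row_array a -> g a (nth 0%N (support_rows j) i)
                                     = F a (nth 0%N (support_rows j) i)) /\ g 5%N i = G i));
  rewrite h5 //.
- move=> i k a z hi hk [[ra zi]|[a5 zi]] [[ra' zk]|[a5' zk]].
  + by apply/eqP; rewrite -(nth_uniq 0%N hi hk un) -zi -zk.
  + by rewrite a5' in ra.
  + by rewrite a5 in ra'.
  + by rewrite -zi.
- by move=> i a z _ [[ra _]|[-> _]] // a0; rewrite a0 in ra.
move=> f h1 h2; apply: hQ.
- move=> a ra; apply/funext => z.
  have [zr|zr] := boolP (z \in support_rows j); last first.
    rewrite h2 ?hF //; first by apply/eqP; rewrite -[_ == _]negbK -mem_support_rows.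
    move=> i hi [[_ zi]|[a5]]; last by rewrite a5 in ra.
    by rewrite zi mem_nth in zr.
  (* Row [z] is handled by the thread whose number is the position of [z] in the column. *)
  have il : (index z (support_rows j) < size (support_rows j))%N by rewrite index_mem.
  have [g [[/(_ a ra) + _] /(_ a z)]] := h1 _ il; rewrite nth_index // => <-.
  by apply; left.
- by apply/funext => z; apply: h2 => i hi [[]|[]].
- by apply/funext => z; apply: h2 => i hi [[]|[]].
- by move=> i hi; have [g [[_ gG] ->]] := h1 i hi => //; right.
Qed.

Record loaded (L : nat) s : Prop := Good {
  loaded_ptr : imem s 0 = cptr;
  loaded_row : imem s 1 = crow;
  loaded_val : rmem s 0 = cval;
  loaded_imp : rmem s 1 = iv;
  loaded_n : ireg s 0 = n;
  loaded_m : ireg s 1 = m;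
  loaded_1 : ireg s 2 = 1%N;
  loaded_M : rreg s 0 = M;
  loaded_r1 : rreg s 1 = 1;
  loaded_L : rreg s 2 = L%:R }.

Lemma runs_load_column L j s cs w d Q : loaded L s -> ireg s 3 = j -> (j < n)%N ->
  (forall t, loaded L t -> ireg t 3 = j -> ireg t 4 = cptr j ->
     ireg t 5 = size (support_rows j) -> rreg t = rreg s -> rmem t = rmem s ->
     runs any_cell any_cell (seqs cs) t w d Q) ->
  runs any_cell any_cell (seqs (load_column ++ cs)) s w.+4 d.+4 Q.
Proof.
move=> [gp ? ? ? ? ? g1 ? ? ?] h3 jn h.
do 4! (apply: runs_atom => //=).
by apply: h => //; rewrite /upd /= ?g1 ?h3 ?addn1 ?gp ?cptrS ?addKn.
Qed.

Definition at_cell L j i s : Prop :=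
  [/\ loaded L s, (j < n)%N, (i < size (support_rows j))%N, ireg s 4 = cptr j
    & ireg s 6 = i].

Lemma runs_column_cell L j i s cs rd wr w d Q : at_cell L j i s ->
  (forall z, rd 0%N z) ->
  (forall t, ireg t 6 = i -> ireg t 8 = nth 0%N (support_rows j) i ->
     rreg t = upd (rreg s) 5 (av (nth 0%N (support_rows j) i) j) -> rmem t = rmem s ->
     runs rd wr (seqs cs) t w d Q) ->
  runs rd wr (seqs (column_cell ++ cs)) s w.+3 d.+3 Q.
Proof.
move=> [[? gr gv ? ? ? ? ? ? ?] jn isz h4 h6] hrd h.
do 3! (apply: runs_atom => //=).
by apply: h => //=; rewrite /upd /= ?gr ?gv ?h4 ?h6 ?crowE ?cvalE.
Qed.

Definition clip (c : R) : R := if 1 < 4 * c ^+ 2 then 0 else c.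

Lemma runs_clipped_cell L j i s cs rd wr w d Q : at_cell L j i s ->
  let r := nth 0%N (support_rows j) i in
  (forall z, rd 0%N z) -> rd 6%N r ->
  (forall t, ireg t 6 = i -> ireg t 8 = r ->
     rreg t 5 = av r j -> rreg t 7 = clip (rmem s 6 r * av r j) ->
     (forall x, x \notin [:: 5; 7; 8]%N -> rreg t x = rreg s x) ->
     rmem t = rmem s -> runs rd wr (seqs cs) t w d Q) ->
  runs rd wr (seqs (clipped_cell ++ cs)) s (w + 10) (d + 10) Q.
Proof.
move=> ac r hrd hrd6 h; rewrite /clipped_cell -catA !addnS !addn0.
apply: (runs_column_cell ac) => // t h6 h8 hr hm.
do 5! (apply: runs_atom; rewrite //= ?h8 //).
apply: runs_if; rewrite /= /upd /= hm hr /upd /=.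
have gr1 : rreg s 1 = 1 by case: ac => -[].
rewrite gr1; set c := rmem s 6 r * _.
have -> : c * c + c * c + (c * c + c * c) = 4 * c ^+ 2 by ring.
have fr x : x \notin [:: 5; 7; 8]%N -> [/\ x == 5%N = false, x == 7%N = false & x == 8%N = false].
  by rewrite !inE !negb_or => /and3P[/negbTE -> /negbTE -> /negbTE ->].
case: ifP => hc; (apply: runs_atom; rewrite //=; apply: h; rewrite //= /upd /=
  ?hr /upd /= ?mulr0n /clip ?hc //) => x /fr[x5 x7 x8]; by rewrite x5 x7 x8.
Qed.

Lemma runs_row_stats L j i s : at_cell L j i s ->
  let r := nth 0%N (support_rows j) i in
  runs (fun a z => private_cell i r a z \/ a = 0%N) (private_cell i r) row_stats s 16 16
    (fun t => [/\ rmem t 3 r = rmem s 3 r + av r j ^+ 2,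
                  rmem t 4 r = rmem s 4 r + `|av r j|,
                  rmem t 5 i = iv r * av r j ^+ 2
                & forall a, a \notin [:: 3; 4; 5]%N -> rmem t a = rmem s a]).
Proof.
move=> ac r; have iv1 : rmem s 1 = iv by case: ac => -[].
apply: (runs_column_cell ac); first by move=> z; right.
move=> t h6 h8 hr hm; set v := av _ j in hr.
do 8! (apply: runs_atom; [by [] | by rewrite /= ?h6 ?h8; owned | rewrite /=]).
apply: runs_if; rewrite /= /upd /= hr /upd /= mulr0n.
have fr a : a \notin [:: 3; 4; 5]%N -> [/\ a == 3%N = false, a == 4%N = false & a == 5%N = false].
  by rewrite !inE !negb_or => /and3P[/negbTE -> /negbTE -> /negbTE ->].
case: ltP => hv;
(do 4! (apply: runs_atom; [by [] | by rewrite /= ?h6 ?h8; owned | rewrite /=]));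
apply: runs_skip; rewrite /= /upd /= h6 h8 hr hm /upd /= !eqxx ?mulr0n -expr2 iv1.
  split=> //; first by rewrite sub0r ltr0_norm.
  by move=> a /fr[-> -> ->].
split=> //; first by rewrite ger0_norm.
by move=> a /fr[-> -> ->].
Qed.

Lemma runs_potential_slope L j i s : at_cell L j i s ->
  let r := nth 0%N (support_rows j) i in
  runs (fun a z => private_cell i r a z \/ a = 0%N) (private_cell i r) potential_slope s 23 23
    (fun t => rmem t 5 i =
         (rmem s 8 r - rmem s 9 r) * clip (rmem s 6 r * av r j) * rreg s 4
         + 2 * (iv r / rreg s 3 * av r j * rmem s 7 r)
       /\ forall a, a != 5%N -> rmem t a = rmem s a).
Proof.
move=> ac r; have iv1 : rmem s 1 = iv by case: ac => -[].
apply: (runs_clipped_cell (w := 13) (d := 13) ac).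
- by move=> z; right.
- by left; left.
move=> t h6 h8 h5 h7 hr hm; rewrite -/r in h8 h5 h7.
do 13! (apply: runs_atom; [by [] | by rewrite /= ?h6 ?h8; owned | rewrite /=]).
apply: runs_skip; rewrite /= /upd /= h6 h8 hm h5 h7 !hr // iv1 !eqxx; split; first by ring.
by move=> a /negbTE ->.
Qed.

Lemma runs_row_update L j i s : at_cell L j i s ->
  let r := nth 0%N (support_rows j) i in
  let b := clip (rmem s 6 r * av r j) in
  runs (fun a z => private_cell i r a z \/ a = 0%N) (private_cell i r) row_update s 23 23
    (fun t => [/\ rmem t 7 r = rmem s 7 r + av r j * rreg s 6,
                  rmem t 8 r = rmem s 8 r * (1 + b * rreg s 6),
                  rmem t 9 r = rmem s 9 r * (1 - b * rreg s 6)
                & forall a, a \notin [:: 7; 8; 9]%N -> rmem t a = rmem s a]).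
Proof.
move=> ac r b; have r1 : rreg s 1 = 1 by case: ac => -[].
apply: (runs_clipped_cell (w := 13) (d := 13) ac).
- by move=> z; right.
- by left; left.
move=> t h6 h8 h5 h7 hr hm; rewrite -/r -/b in h8 h5 h7.
do 13! (apply: runs_atom; [by [] | by rewrite /= ?h6 ?h8; owned | rewrite /=]).
apply: runs_skip; rewrite /= /upd /= h8 hm h5 h7 !hr // r1 !eqxx; split=> //.
by move=> a; rewrite !inE !negb_or => /and3P[/negbTE -> /negbTE -> /negbTE ->].
Qed.

Lemma loaded_same_context L s t : loaded L s -> same_context s t ->
  rmem t 0 = rmem s 0 -> rmem t 1 = rmem s 1 -> loaded L t.
Proof.
move=> [g1 g2 g3 g4 g5 g6 g7 g8 g9 g10] [hi hr hq] h0 h1.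
by split; rewrite ?hi ?hr ?hq ?h0 ?h1.
Qed.

Lemma at_cell_fork L j i s : loaded L s -> (j < n)%N -> ireg s 4 = cptr j ->
  (i < size (support_rows j))%N -> at_cell L j i (set_ireg s 6 i).
Proof. by case. Qed.

(** * Row statistics and total weight *)

Definition row_sq (k x : nat) : R := \sum_(j < k) av x j ^+ 2.
Definition row_abs (k x : nat) : R := \sum_(j < k) `|av x j|.

Definition stats_inv L j s : Prop :=
  [/\ loaded L s, ireg s 3 = j,
      rreg s 3 = \sum_(k < j) \sum_(x < m) iv x * av x k ^+ 2,
      rmem s 3 = row_sq j /\ rmem s 4 = row_abs j
    & rmem s 7 = fun=> 0].

(** A column has at most [m <= 2 ^ L] nonzero entries, so [reduce] needs no more than [L] rounds. *)
Lemma runs_stats_pass L j s : (m <= 2 ^ L)%N -> (j < n)%N -> stats_inv L j s ->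
  runs any_cell any_cell stats_pass s (L.+1 * (30 * size (support_rows j) + 30)) (L.+1 * 40)
    (stats_inv L j.+1).
Proof.
move=> mL jn [gs h3 hS [hm3 hm4] hm7].
have sz := size_support_rows j.
apply: (runs_weaken
  (w' := ((size (support_rows j) * 17).+1 + ((L * (6 * size (support_rows j) + 5) + 10) + 2)).+4)
  (d' := (17 + ((L * 12 + 10) + 2)).+4)); [nia..|].
apply: (runs_load_column gs h3 jn) => t gt t3 t4 t5 tr tm.
apply: runs_cons; rewrite -tm in hm3 hm4 hm7; rewrite -tr in hS.
apply: (runs_col (F := fun a z => match a with
   | 3 => rmem t 3 z + av z j ^+ 2 | 4 => rmem t 4 z + `|av z j|
   | _ => rmem t a z end) (G := fun i => let r := nth 0%N (support_rows j) i in
   iv r * av r j ^+ 2) t5).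
- move=> i isz /=; apply: runs_post (runs_row_stats (at_cell_fork gt jn t4 isz)).
  move=> u [u3 u4 u5 u_]; split; last by rewrite u5.
  by apply: row_array_ind; rewrite ?u3 ?u4 ?u_.
- move=> a z ra z0; move: a ra; apply: row_array_ind => //;
  by rewrite z0 ?normr0 ?expr0n ?addr0.
move=> f fF f0 f2 f5; apply: runs_cons.
set u := State _ _ _ f.
have mL' : (ireg u 5 <= 2 ^ L)%N by rewrite /= t5 (leq_trans sz).
have u2 : ireg u 2 = 1%N by rewrite /= (loaded_1 gt).
rewrite -t5; apply: runs_post (runs_reduce u2 mL') => v [uv vm v5].
have vu a : a != 5%N -> rmem v a = f a by exact: vm.
have sv : same_context t v by case: uv => /= *; split.
do 2! (apply: runs_atom; [by []|by []|rewrite /=]); apply: runs_skip.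
have gv : loaded L v.
  by apply: (loaded_same_context gt sv); rewrite vu //= ?fF ?f0 // fF.
case: (sv) => _ vi vr.
split.
- by case: gv.
- by rewrite /= /upd /= vi // t3 (loaded_1 gv) addn1.
- rewrite /= /upd /= vr // hS v5 big_ord_recr /= t5; congr (_ + _).
  rewrite (eq_bigr (fun i : 'I_(size (support_rows j)) => let r := nth 0%N (support_rows j) i in
     iv r * av r j ^+ 2)); last by move=> i _; rewrite f5.
  by rewrite (@sum_support_rows j (fun r => iv r * av r j ^+ 2)) // => x ->; rewrite expr0n mulr0.
- rewrite /= !vu // !fF //=; split; apply/funext => x.
  + by rewrite hm3 /row_sq big_ord_recr.
  + by rewrite hm4 /row_abs big_ord_recr.
- by rewrite /= vu // fF //= hm7.
Qed.

Lemma runs_stats L s : (m <= 2 ^ L)%N -> stats_inv L 0 s ->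
  runs any_cell any_cell (While (ILt 3 0) stats_pass) s
    (\sum_(j < n) (L.+1 * (30 * size (support_rows j) + 30)).+1).+1
    (n * (L.+1 * 40).+1).+1 (stats_inv L n).
Proof.
move=> mL h0; rewrite (reindex_inj rev_ord_inj) /=.
(* The variant [k] counts the columns left, whereas the columns are visited in increasing order;
   hence the backward reindexing of the sum. *)
apply: (runs_while (w := fun k => (L.+1 * (30 * size (support_rows (n - k)) + 30))%N)
  (Inv := fun k t => (k <= n)%N /\ stats_inv L (n - k) t)); last by rewrite subnn.
- move=> k t [kn it]; case: (it) => gt t3 _ _ _ /=.
  rewrite t3 (loaded_n gt) => h; split; first by lia.
  apply: runs_post (runs_stats_pass mL _ it) => // u.
  by rewrite (_ : (n - k).+1 = n - k.-1)%N; [split=> //; lia | lia].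
- move=> k t [kn it]; case: (it) => gt t3 _ _ _ /=.
  rewrite t3 (loaded_n gt) -leqNgt => h.
  by rewrite (_ : n - k = n)%N in it; last lia.
Qed.

(** * Scales of the rows *)

Definition scaled L (sg lam : R) : Prop :=
  exists rho : R, [/\ lam = rho^-1, 0 <= rho, L%:R * rho ^+ 2 <= sg
                    & sg <= 4 * (L%:R * rho ^+ 2)].

Lemma runs_scale_row L K s x :
  rreg s 1 = 1 -> rreg s 2 = L%:R -> ireg s 6 = x -> 0 <= rmem s 4 x ->
  rmem s 3 x <= L%:R * rmem s 4 x ^+ 2 ->
  L%:R * rmem s 4 x ^+ 2 <= 4 ^+ K * rmem s 3 x ->
  let own a z := row_array a /\ z = x in
  runs (fun a z => own a z \/ False) own scale_row s (4 * K + 10) (4 * K + 10)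
    (fun t => [/\ scaled L (rmem s 3 x) (rmem t 6 x), rmem t 8 x = 1,
                  rmem t 9 x = 1
                & forall a, a \notin [:: 6; 8; 9]%N -> rmem t a = rmem s a]).
Proof.
move=> s1 s2 s6 T0 sgT TK own.
apply: (runs_weaken (w' := ((\sum_(i < K) 4).+1 + 4).+4.+1)
                    (d' := ((K * 4).+1 + 4).+4.+1)).
- by rewrite sum_nat_const card_ord; lia.
- by lia.
do 5! (apply: runs_atom; [by [] | by rewrite /= ?s6; owned | rewrite /=]).
apply: runs_cons.
(* At most [k] halvings remain, each dividing [L rho ^ 2] by 4. The bound [sg <= 4 L rho ^ 2] holds
   at the start even without the factor 4, and after a halving because the guard was true before
   it. *)
pose Inv k t := [/\ ireg t = ireg s, rmem t = rmem s,
  [/\ rreg t 1 = 1, rreg t 2 = L%:R & rreg t 8 = 2],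
  rreg t 5 = rmem s 3 x /\ rreg t 7 = L%:R * rreg t 6 ^+ 2
  & [/\ 0 <= rreg t 6, rmem s 3 x <= 4 * rreg t 7
      & rreg t 7 <= 4 ^+ k * rmem s 3 x]].
apply: (runs_while (w := fun=> 3) (Inv := Inv)).
- move=> k t [hi hm [t1 t2 t8] [t5 t7] [p6 p7 p7']] /=; rewrite t5 => hlt; split.
    by case: k p7' => // p7'; move: (lt_le_trans hlt p7'); rewrite mul1r ltxx.
  do 3! (apply: runs_atom; [by [] | by rewrite /= ?s6; owned | rewrite /=]).
  apply: runs_skip; rewrite /Inv /= /upd /= t2 t8 t1 t5.
  have e : rreg t 6 / 2 * (rreg t 6 / 2) * L%:R = 4^-1 * rreg t 7.
    by rewrite t7; field.
  split=> //; first by split=> //; rewrite mulrC -expr2.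
  rewrite e; split; first by rewrite divr_ge0.
    by rewrite mulrA divff ?pnatr_eq0 // mul1r ltW.
  case: k p7' => [|k] p7'; first by move: (lt_le_trans hlt p7'); rewrite mul1r ltxx.
  by rewrite ler_pdivrMl // mulrA -exprS.
- move=> k t [hi hm [t1 t2 t8] [t5 t7] [p6 p7 p7']] /=; rewrite t5 -leNgt => hle.
  do 4! (apply: runs_atom; [by [] | by rewrite /= ?hi ?s6; owned | rewrite /=]).
  apply: runs_skip; rewrite /= /upd /= hi s6 hm t1 !eqxx; split=> //.
    (* For a zero row [rho] is 0, and so is the stored inverse, by the convention for division. *)
    by exists (rreg t 6); rewrite -t7 div1r.
  by move=> a; rewrite !inE !negb_or => /and3P[/negbTE -> /negbTE -> /negbTE ->].
- rewrite /Inv /= /upd /= s1 s2 s6 -expr2 mulrC; split=> //; split=> //.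
  by apply: (le_trans sgT); rewrite ler_peMl ?ler1n // mulr_ge0 ?sqr_ge0.
Qed.

Definition scaled_inv L s : Prop :=
  [/\ stats_inv L n s, forall x, (x < m)%N -> scaled L (row_sq n x) (rmem s 6 x)
    & forall x, (x < m)%N -> rmem s 8 x = 1 /\ rmem s 9 x = 1].

Lemma runs_scale L K s : (0 < L)%N -> stats_inv L n s ->
  (forall x, row_sq n x <= row_abs n x ^+ 2) ->
  (forall x, L%:R * row_abs n x ^+ 2 <= 4 ^+ K * row_sq n x) ->
  runs any_cell any_cell (Par 6 1 scale_row) s (m * (4 * K + 11)).+1 (4 * K + 11)
    (scaled_inv L).
Proof.
move=> L0 is_ sqab abK; case: (is_) => gs h3 hS [hm3 hm4] hm7.
have gm := loaded_m gs; rewrite -{1}gm addnS.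
apply: (@runs_par _ _ _ _ _ _ _ _ _ (fun i a z => row_array a /\ z = i)
  (fun _ _ => False) (fun i g => [/\ scaled L (row_sq n i) (g 6%N i), g 8%N i = 1,
    g 9%N i = 1 & forall a, a \notin [:: 6; 8; 9]%N -> g a = rmem s a])) => //.
- move=> i im.
  have sl : scaled L (rmem s 3 i) = scaled L (row_sq n i) by rewrite hm3.
  rewrite -sl; apply: (@runs_scale_row L K (set_ireg s 6 i) i) => //=.
  + exact: loaded_r1 gs.
  + exact: loaded_L gs.
  + by rewrite hm4 sumr_ge0.
  + rewrite hm3 hm4 (le_trans (sqab i)) // ler_peMl ?sqr_ge0 ?ler1n //.
  + by rewrite hm3 hm4.
- by move=> i j a z _ _ [_ ->] [_ ->].
rewrite gm => f f1 f2.
have fs a : a \notin [:: 6; 8; 9]%N -> f a = rmem s a.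
  move=> na; apply/funext => z.
  have [[ra zm]|h] := pselect (row_array a /\ (z < m)%N).
    by have [g [[_ _ _ gs'] gf]] := f1 z zm; rewrite gf ?gs'.
  by apply: f2 => i im [ra zi]; apply: h; rewrite zi.
split.
- split=> //=; rewrite ?fs //.
  by apply: (loaded_same_context gs); rewrite //= fs.
- by move=> x xm /=; have [g [[? _ _ _] gf]] := f1 x xm; rewrite gf.
- by move=> x xm /=; have [g [[_ ? ? _] gf]] := f1 x xm; rewrite !gf.
Qed.

(** * The choice of the signs *)

Definition potential (S delta : R) (j : nat) (d p q : nat -> R) : R :=
  \sum_(x < m) (iv x / S * (d x ^+ 2 - row_sq j x) + delta * (p x + q x)).

(** The identities for the rows are restricted to [x < m] because the products are initialised only
    there. The bound [c] will be the initial value of the potential. *)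
Record sign_inv L (lam : nat -> R) (S delta c : R) (j : nat) s : Prop := SignInv {
  sign_loaded : loaded L s;
  sign_j : ireg s 3 = j;
  sign_S : rreg s 3 = S;
  sign_delta : rreg s 4 = delta;
  sign_lam : rmem s 6 = lam;
  sign_chi : forall k, (k < j)%N -> rmem s 2 k = -1 \/ rmem s 2 k = 1;
  sign_d : forall x, (x < m)%N ->
    rmem s 7 x = \sum_(k < j) av x k * rmem s 2 k;
  sign_p : forall x, (x < m)%N ->
    rmem s 8 x = \prod_(k < j) (1 + clip (lam x * av x k) * rmem s 2 k);
  sign_q : forall x, (x < m)%N ->
    rmem s 9 x = \prod_(k < j) (1 - clip (lam x * av x k) * rmem s 2 k);
  sign_potential :
    potential S delta j (rmem s 7) (rmem s 8) (rmem s 9) <= c }.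

Lemma clip0 : clip 0 = 0.
Proof. by rewrite /clip; case: ifP. Qed.

(* The potential is affine in the sign of the new column, so one of the two
   signs does not increase it. *)
Lemma potential_step (S delta chi : R) (j : nat) (b d p q d' p' q' : nat -> R) :
  chi = -1 \/ chi = 1 ->
  (forall x, d' x = d x + av x j * chi) ->
  (forall x, p' x = p x * (1 + b x * chi)) ->
  (forall x, q' x = q x * (1 - b x * chi)) ->
  potential S delta j.+1 d' p' q' = potential S delta j d p q
    + chi * \sum_(x < m) ((p x - q x) * b x * delta
                          + 2 * (iv x / S * av x j * d x)).
Proof.
move=> hchi hd hp hq; rewrite mulr_sumr -big_split /=.
apply: eq_bigr => x _; rewrite hd hp hq /row_sq big_ord_recr /=.
(* Since [chi ^ 2 = 1], the square of the new entry cancels the new term of [row_sq], and only terms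
   linear in [chi] remain. *)
have chi2 : chi * chi = 1 by case: hchi => ->; rewrite ?mulrNN mulr1.
set T := \sum_(i < j) _.
have -> : (d x + av x j * chi) ^+ 2
    = d x ^+ 2 + 2 * d x * av x j * chi + av x j ^+ 2 * (chi * chi) by ring.
by rewrite chi2; ring.
Qed.

Lemma runs_sign_pass L lam S delta c j s : (m <= 2 ^ L)%N -> (j < n)%N ->
  sign_inv L lam S delta c j s ->
  runs any_cell any_cell sign_pass s (L.+1 * (70 * size (support_rows j) + 70)) (L.+1 * 80)
    (sign_inv L lam S delta c j.+1).
Proof.
move=> mL jn [gs h3 hS hdel hlam hchi hd hp hq hpot].
have sz := size_support_rows j.
apply: (runs_weaken
  (w' := ((size (support_rows j) * 24).+1 + ((L * (6 * size (support_rows j) + 5) + 10) +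
         ((size (support_rows j) * 24).+1 + 1).+4)).+4)
  (d' := (24 + ((L * 12 + 10) + (24 + 1).+4)).+4)); [nia..|].
apply: (runs_load_column gs h3 jn) => t gt t3 t4 t5 tr tm.
apply: runs_cons.
pose b x := clip (lam x * av x j).
pose g x := (rmem s 8 x - rmem s 9 x) * b x * delta
              + 2 * (iv x / S * av x j * rmem s 7 x).
apply: (runs_col (F := rmem s) (G := fun i => g (nth 0%N (support_rows j) i)) t5).
- move=> i isz /=.
  apply: runs_post (runs_potential_slope (at_cell_fork gt jn t4 isz)) => u /=.
  rewrite tm tr hlam hS hdel => -[u5 u_]; split=> //.
  by apply: row_array_ind; rewrite u_.
- by move=> a z _ _; rewrite tm.
rewrite tm => f fF f0 f2 f5; apply: runs_cons.
set u := State _ _ _ f.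
have mL' : (ireg u 5 <= 2 ^ L)%N by rewrite /= t5 (leq_trans sz).
have u2 : ireg u 2 = 1%N by rewrite /= (loaded_1 gt).
rewrite -{1}t5; apply: runs_post (runs_reduce u2 mL') => v [uv vm v5].
have vs a : (a < 10)%N -> a != 5%N -> rmem v a = rmem s a.
  move=> a10 a5; rewrite vm //=.
  have [ra|] := boolP (row_array a); first exact: fF.
  by move: a a10 a5 => [|[|[|[|[|[|[|[|[|[|a]]]]]]]]]].
have vD : rreg v 5 = \sum_(x < m) g x.
  (* A row with a zero entry contributes nothing to the slope, since [clip 0 = 0]. *)
  rewrite v5 /= t5 -(@sum_support_rows j g) => [|x x0]; last first.
    by rewrite /g /b x0 mulr0 clip0 !(mulr0, mul0r) addr0.
  by apply: eq_bigr => i _; rewrite f5.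
have sv : same_context t v by case: uv => /= *; split.
have gv : loaded L v.
  by apply: (loaded_same_context gt sv); rewrite vs // tm.
case: (sv) => _ vi vr.
apply: runs_atom; [by []|by []|rewrite /=].
(* After the reduction real register 5 holds the slope; the sign is chosen against it. *)
pose chi : R := if 0 < rreg v 5 then -1 else 1.
have chiP : chi = -1 \/ chi = 1 by rewrite /chi; case: ifP; auto.
have chiD : chi * rreg v 5 <= 0.
  by rewrite /chi; case: ltP => h; rewrite ?mulN1r ?mul1r // oppr_le0 ltW.
apply: runs_if.
pose w1 := set_rreg (set_rreg v 7 0) 6 chi.
(* Both branches leave the chosen sign in real register 6, so the remaining commands are verified
   once for both. *)
suff main : runs any_cell any_cell (seqs [:: RStore 2 3 6; Par 6 5 row_update; IBin IAdd 3 3 2])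
    w1 ((size (support_rows j) * 24).+1 + 1).+1 (24 + 1).+1 (sign_inv L lam S delta c j.+1).
  rewrite /= /upd /= mulr0n; move: main; rewrite /w1 /chi.
  case: ifP => _ main; (apply: runs_atom; [by []|by []|]);
    by rewrite /= /upd /= ?mulr0n ?(loaded_r1 gv) ?sub0r ?add0r.
apply: runs_atom; [by []|by []|rewrite /=].
apply: runs_cons.
set w2 := set_rmem _ _ _ _.
have w24 : ireg w2 4 = cptr j by rewrite /= vi.
have w25 : ireg w2 5 = size (support_rows j) by rewrite /= vi.
have gw2 : loaded L w2 by case: gv.
have w2m a : (a < 10)%N -> a != 5%N -> a != 2%N -> rmem w2 a = rmem s a.
  by move=> a10 a5 /negbTE a2; rewrite /= /upd /= a2 vs.
have w22 k : rmem w2 2 k = if k == j then chi else rmem s 2 k.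
  by rewrite /= /upd /= vi // t3 vs.
apply: (runs_col (F := fun a x => match a with
    | 7 => rmem s 7 x + av x j * chi
    | 8 => rmem s 8 x * (1 + b x * chi)
    | 9 => rmem s 9 x * (1 - b x * chi)
    | _ => rmem w2 a x end) (G := fun i => rmem w2 5 i) w25).
- move=> i isz r; apply: runs_post (runs_row_update (at_cell_fork gw2 jn w24 isz)).
  move=> y [y7 y8 y9 y_]; split; last by rewrite y_.
  rewrite -/r in y7 y8 y9.
  have w26' : rreg (set_ireg w2 6 i) 6 = chi by [].
  have rm a : rmem (set_ireg w2 6 i) a = rmem w2 a by [].
  rewrite w26' !rm !w2m // hlam in y7 y8 y9.
  by apply: row_array_ind; rewrite // y_.
- move=> a z ra z0; move: a ra; apply: row_array_ind => //;
  by rewrite !w2m // /b z0 ?mulr0 ?clip0 ?mul0r ?subr0 ?addr0 ?mulr1.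
move=> f' f'F f'0 f'2 _; apply: runs_atom; [by []|by []|rewrite /=].
apply: runs_skip.
have f'2k k : f' 2%N k = if k == j then chi else rmem s 2 k by rewrite f'2 w22.
have f'lt k : (k < j)%N -> f' 2%N k = rmem s 2 k by rewrite f'2k => /ltn_eqF ->.
have f'j : f' 2%N j = chi by rewrite f'2k eqxx.
split=> /=.
- case: (gw2) => *; split=> //=; first by rewrite f'0.
  by rewrite f'F.
- by rewrite /upd /= vi // t3 (loaded_1 gv) addn1.
- by rewrite /upd /= vr // tr.
- by rewrite /upd /= vr // tr.
- by rewrite f'F //= -hlam -w2m.
- move=> k; rewrite ltnS f'2k leq_eqVlt; case: eqP => // _ /=; exact: hchi.
- move=> x xm; rewrite f'F //= big_ord_recr /= f'j hd //; congr (_ + _).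
  by apply: eq_bigr => k _; rewrite f'lt.
- move=> x xm; rewrite f'F //= big_ord_recr /= f'j hp //; congr (_ * _).
  by apply: eq_bigr => k _; rewrite f'lt.
- move=> x xm; rewrite f'F //= big_ord_recr /= f'j hq //; congr (_ * _).
  by apply: eq_bigr => k _; rewrite f'lt.
- rewrite !f'F //= (potential_step (b := b) (d := rmem s 7) (p := rmem s 8)
    (q := rmem s 9) _ _ chiP) //.
  by rewrite -vD -[c]addr0 lerD.
Qed.

Lemma runs_signs L lam S delta c s : (m <= 2 ^ L)%N ->
  sign_inv L lam S delta c 0 s ->
  runs any_cell any_cell (While (ILt 3 0) sign_pass) s
    (\sum_(j < n) (L.+1 * (70 * size (support_rows j) + 70)).+1).+1
    (n * (L.+1 * 80).+1).+1 (sign_inv L lam S delta c n).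
Proof.
move=> mL h0; rewrite (reindex_inj rev_ord_inj) /=.
apply: (runs_while (w := fun k => (L.+1 * (70 * size (support_rows (n - k)) + 70))%N)
  (Inv := fun k t => (k <= n)%N /\ sign_inv L lam S delta c (n - k) t));
  last by rewrite subnn.
- move=> k t [kn it] /=.
  rewrite (sign_j it) (loaded_n (sign_loaded it)) => h; split; first by lia.
  apply: runs_post (runs_sign_pass mL _ it) => // u.
  by rewrite (_ : (n - k).+1 = n - k.-1)%N; [split=> //; lia | lia].
- move=> k t [kn it] /=.
  rewrite (sign_j it) (loaded_n (sign_loaded it)) -leqNgt => h.
  by rewrite (_ : n - k = n)%N in it; last lia.
Qed.

(** * The complete program *)

Lemma runs_log L s (Q : state R -> Prop) : M <= 2 ^+ L ->
  (forall l, M <= 2 ^+ l -> (L <= l)%N) ->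
  rreg s 0 = M -> rreg s 1 = 1 -> rreg s 2 = 0 -> rreg s 5 = 1 ->
  (forall t, imem t = imem s -> rmem t = rmem s -> ireg t = ireg s ->
     rreg t 0 = M -> rreg t 1 = 1 -> rreg t 2 = L%:R -> Q t) ->
  runs any_cell any_cell (While (RLt 5 0) (seqs [:: RBin RAdd 5 5 5; RBin RAdd 2 2 1]))
    s (L * 3).+1 (L * 3).+1 Q.
Proof.
move=> ML Lmin s0 s1 s2 s5 hQ.
apply: (runs_weaken (w' := (\sum_(i < L) 3).+1) (d' := (L * 3).+1)) => //.
  by rewrite sum_nat_const card_ord.
(* After [L - k] doublings the loop goes on only if [2 ^ (L - k) < M], which excludes [k = 0]; when
   it stops, minimality of [L] forces [k = 0]. *)
pose Inv k t := [/\ (k <= L)%N, [/\ imem t = imem s, rmem t = rmem s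
    & ireg t = ireg s], rreg t 0 = M /\ rreg t 1 = 1,
  rreg t 2 = (L - k)%:R & rreg t 5 = 2 ^+ (L - k)].
apply: (runs_while (w := fun=> 2) (Inv := Inv)).
- move=> k t [kL [? ? ?] [t0 t1] t2 t5] /=; rewrite t0 t5 => lt; split.
    by case: k kL t2 t5 lt => // _ _ _; rewrite subn0 ltNge ML.
  do 2! (apply: runs_atom; [by [] | by [] | rewrite /=]).
  have k0 : (0 < k)%N by case: k kL t2 t5 lt => // _ _ _; rewrite subn0 ltNge ML.
  have e : (L - k.-1 = (L - k).+1)%N by lia.
  apply: runs_skip; split; rewrite ?e //=.
  + by lia.
  + by rewrite /upd /= t2 t1 -natr1.
  + by rewrite /upd /= t5 exprS mulr_natl mulr2n.
- move=> k t [kL [? ? ?] [t0 t1] t2 t5] /=; rewrite t0 t5 -leNgt => /Lmin h.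
  by apply: hQ => //; rewrite t2; congr (_%:R); lia.
- by split=> //; rewrite subnn.
Qed.

Definition total_weight : R := \sum_(k < n) \sum_(x < m) iv x * av x k ^+ 2.

(** This is [1 / (2 M ^ 2)], written as the program computes it. For [m <= M] it keeps the initial
    potential [2 m delta] at most [1 / M], while [1 / delta] stays polynomial in [M]. *)
Definition delta : R := 1 / (M * M + M * M).

Lemma runs_balance L K s : (0 < L)%N -> M <= 2 ^+ L ->
  (forall l, M <= 2 ^+ l -> (L <= l)%N) -> (m <= 2 ^ L)%N ->
  (forall x, row_sq n x <= row_abs n x ^+ 2) ->
  (forall x, L%:R * row_abs n x ^+ 2 <= 4 ^+ K * row_sq n x) ->
  imem s 0 = cptr -> imem s 1 = crow -> rmem s 0 = cval -> rmem s 1 = iv ->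
  ireg s 0 = n -> ireg s 1 = m -> rreg s 0 = M ->
  (forall a, a \in [:: 3; 4; 7]%N -> rmem s a = fun=> 0) ->
  let N := (\sum_(j < n) size (support_rows j) + n + m)%N in
  runs any_cell any_cell balance s (200 * N.+1 * (L + K).+1) (200 * n.+1 * L.+1 + 4 * K)
    (fun t => exists lam,
       sign_inv L lam total_weight delta (2 * m%:R * delta) n t /\
       forall x, (x < m)%N -> scaled L (row_sq n x) (lam x)).
Proof.
move=> L0 ML Lmin mL sqab abK sp srow sval simp sn sm sM sz N.
pose Z := (\sum_(j < n) size (support_rows j))%N.
have sumE a b : (\sum_(j < n) (L.+1 * (a * size (support_rows j) + b)).+1 =
    L.+1 * (a * Z + b * n) + n)%N.
  rewrite /Z; elim: {N} n => [|k IH]; first by rewrite !big_ord0 !muln0.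
  rewrite !big_ord_recr /= IH; move: (\sum_(i < k) _)%N (size _) => y z.
  by rewrite -addn1; ring.
apply: (runs_weaken
  (w' := ((L * 3).+1 + ((\sum_(j < n) (L.+1 * (30 * size (support_rows j) + 30)).+1).+1 +
    ((m * (4 * K + 11)).+1 +
     ((\sum_(j < n) (L.+1 * (70 * size (support_rows j) + 70)).+1).+1 + 0).+4)).+3).+3)
  (d' := ((L * 3).+1 + ((n * (L.+1 * 40).+1).+1 +
    ((4 * K + 11) + ((n * (L.+1 * 80).+1).+1 + 0).+4)).+3).+3)).
- by rewrite !sumE /N -/Z; nia.
- by nia.
do 3! (apply: runs_atom; [by [] | by [] | rewrite /=]).
apply: runs_cons; apply: (runs_log ML Lmin) => // t ti tm tir t0 t1 t2.
do 3! (apply: runs_atom; [by [] | by [] | rewrite /=]).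
apply: runs_cons.
apply: runs_post (runs_stats mL _); last first.
  split=> //=.
  - by split=> //=; rewrite ?ti ?tm ?tir.
  - by rewrite /upd /= big_ord0.
  - rewrite tm !sz //; split; apply/funext => x; by rewrite /row_sq /row_abs big_ord0.
  - by rewrite tm sz.
move=> u iu; apply: runs_cons.
apply: runs_post (runs_scale L0 iu sqab abK) => v [iv_ vs vx].
case: iv_ => gv _ vS _ v7.
do 4! (apply: runs_atom; [by [] | by [] | rewrite /=]).
apply: runs_cons.
apply: runs_post (runs_signs (lam := rmem v 6) (S := total_weight)
  (delta := delta) (c := 2 * m%:R * delta) mL _).
  by move=> y iy; apply: runs_skip; exists (rmem v 6).
split=> //=.
- by case: gv.
- by rewrite /upd /= (loaded_M gv) (loaded_r1 gv).
- by move=> x xm; rewrite v7 big_ord0.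
- by move=> x xm; rewrite big_ord0; have [] := vx x xm.
- by move=> x xm; rewrite big_ord0; have [] := vx x xm.
(* Initially the row sums vanish and both products equal 1, so each row contributes [2 delta]. *)
- rewrite /potential (eq_bigr (fun=> 2 * delta)) => [|x _]; last first.
    have [-> ->] := vx x (ltn_ord x).
    by rewrite v7 /row_sq big_ord0 expr0n subr0 mulr0 add0r mulrC.
  by rewrite sumr_const card_ord mulrAC mulr_natr.
Qed.

End Columns.

(** * From the potential to the discrepancy *)

Section Bounds.
Variable R : realType.

(** With [u = y - 2 y ^ 2], [exp u <= 1 / (1 - u)], and [(1 + y) (1 - u) = 1 + y ^ 2 (1 + 2 y)] is
    at least 1. *)
Lemma expR_le1D (y : R) : - (1 / 2) <= y -> expR (y - 2 * y ^+ 2) <= 1 + y.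
Proof.
move=> hy; set u := y - 2 * y ^+ 2.
have u1 : 0 < 1 - u by rewrite /u; nra.
have h : 1 - u <= expR (- u) by exact: expR_ge1Dx.
rewrite -[u]opprK expRN; apply: le_trans (_ : (1 - u)^-1 <= _).
  by rewrite lef_pV2 ?posrE ?expR_gt0.
by rewrite -[leLHS]div1r ler_pdivrMr // /u; nra.
Qed.

Lemma expR_le_prod n (b : nat -> R) : (forall k, - (1 / 2) <= b k) ->
  expR (\sum_(k < n) b k - 2 * \sum_(k < n) b k ^+ 2) <= \prod_(k < n) (1 + b k).
Proof.
move=> hb; rewrite mulr_sumr -sumrB expR_sum.
by apply: ler_prod => k _; rewrite expR_ge0 expR_le1D.
Qed.

(** A clipped [c] has [|c| > 1/2], hence [|c| <= 2 c ^ 2]: what clipping removes is paid for by the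
    sum of squares. *)
Lemma clip_bound (c : R) :
  [/\ `|clip c| <= 1 / 2, clip c ^+ 2 <= c ^+ 2 & `|c - clip c| <= 2 * c ^+ 2].
Proof.
rewrite /clip; case: ltP => h.
  rewrite normr0 expr0n subr0 sqr_ge0; split=> //; first by lra.
  move: h; rewrite -[c ^+ 2](real_normK (num_real c)).
  have := normr_ge0 c; move: `|c| => y y0 h.
  have : 1 / 2 < y by nra.
  by nra.
rewrite subrr normr0 mulr_ge0 ?sqr_ge0 //; split=> //.
by rewrite ler_norml; apply/andP; split; nra.
Qed.

Lemma sum_sq_le_abs n (a : nat -> R) :
  \sum_(k < n) a k ^+ 2 <= (\sum_(k < n) `|a k|) ^+ 2.
Proof.
elim: n => [|n IH]; first by rewrite !big_ord0 expr0n.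
rewrite !big_ord_recr /= -[a n ^+ 2]real_normK ?num_real //.
have : 0 <= \sum_(k < n) `|a k| by apply: sumr_ge0.
by have := normr_ge0 (a n); nra.
Qed.

(** Cauchy-Schwarz against the all-ones vector; it bounds the number of halvings in [scale_row]. *)
Lemma abs_le_sum_sq n (a : nat -> R) :
  (\sum_(k < n) `|a k|) ^+ 2 <= n%:R * \sum_(k < n) a k ^+ 2.
Proof.
elim: n => [|n IH]; first by rewrite !big_ord0 expr0n mul0r.
rewrite !big_ord_recr /= -[a n ^+ 2]real_normK ?num_real // -natr1.
case: n IH => [|n] IH; first by rewrite !big_ord0; nra.
move: IH; set T := \sum_(k < n.+1) `|a k|; set S := \sum_(k < n.+1) _.
set x := `|a n.+1|; set N : R := n.+1%:R => IH.
have N0 : 0 < N by rewrite ltr0n.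
have : 2 * T * x <= N * x ^+ 2 + S.
  by rewrite -(ler_pM2l N0); have := sqr_ge0 (N * x - T); nra.
by nra.
Qed.

(* Entries with [|a k| > rho / 2] are clipped; they contribute at most
   [2 * sg / rho] to the discrepancy whatever their signs. *)
Lemma row_discrepancy n (L : nat) (a chi : nat -> R) (rho : R) :
  let sg := \sum_(k < n) a k ^+ 2 in
  let b k := clip (rho^-1 * a k) in
  0 <= rho -> L%:R * rho ^+ 2 <= sg -> sg <= 4 * (L%:R * rho ^+ 2) ->
  (forall k, (k < n)%N -> chi k = -1 \/ chi k = 1) ->
  \prod_(k < n) (1 + b k * chi k) <= expR (4 * L%:R) ->
  \prod_(k < n) (1 - b k * chi k) <= expR (4 * L%:R) ->
  (\sum_(k < n) a k * chi k) ^+ 2 <= 400 * L%:R * sg.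
Proof.
move=> sg b rho0 Lsg sgL hchi hp hm.
have L0 : 0 <= L%:R :> R by exact: ler0n.
have sg0 : 0 <= sg by apply: sumr_ge0 => k _; exact: sqr_ge0.
(* If [rho] is 0 then so is [sg], hence every entry of the row. *)
move: rho0; rewrite le_eqVlt => /orP[/eqP r0|rp].
  have /eqP sgz : sg == 0.
    by rewrite eq_le sg0 andbT (le_trans sgL) // -r0 expr0n !mulr0.
  rewrite sgz mulr0 big1 ?expr0n // => k _.
  move/eqP: sgz; rewrite psumr_eq0 => [|i _]; last exact: sqr_ge0.
  by move=> /allP/(_ k (mem_index_enum k)); rewrite sqrf_eq0 => /eqP ->; rewrite mul0r.
have chi1 k : (k < n)%N -> `|chi k| = 1.
  by move=> /hchi[] ->; rewrite ?normrN normr1.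
(* Extending the signs by 1 beyond [n] gives absolute value 1 at every index, as [half] requires. *)
pose e k := if (k < n)%N then chi k else 1.
have e1 k : `|e k| = 1 by rewrite /e; case: ifP => [/chi1|_] //; rewrite normr1.
have ce (k : 'I_n) : chi k = e k by rewrite /e ltn_ord.
have sc : \sum_(k < n) (rho^-1 * a k) ^+ 2 <= 4 * L%:R.
  under eq_bigr do rewrite exprMn.
  rewrite -mulr_sumr -/sg exprVn ler_pdivrMl ?exprn_gt0 //.
  by rewrite mulrC -mulrA.
have sb : \sum_(k < n) b k ^+ 2 <= 4 * L%:R.
  apply: le_trans sc; apply: ler_sum => k _.
  by have [] := clip_bound (rho^-1 * a k).
(* By logarithms, the sum is at most [4 L] plus twice the sum of the squares, which is itself at
   most [4 L]. *)
have half (c : nat -> R) : (forall k, `|c k| = 1) ->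
    \prod_(k < n) (1 + b k * c k) <= expR (4 * L%:R) ->
    \sum_(k < n) b k * c k <= 12 * L%:R.
  move=> hc hX.
  have E : \sum_(k < n) (b k * c k) ^+ 2 = \sum_(k < n) b k ^+ 2.
    apply: eq_bigr => k _.
    by rewrite exprMn -[c k ^+ 2]real_normK ?num_real // hc expr1n mulr1.
  have := le_trans (@expR_le_prod n (fun k => b k * c k) _) hX.
  rewrite ler_expR E => h.
  have : \sum_(k < n) b k * c k - 2 * \sum_(k < n) b k ^+ 2 <= 4 * L%:R.
    apply: h => k; have [+ _ _] := clip_bound (rho^-1 * a k).
    rewrite -/(b k) -[`|b k|]mulr1 -(hc k) -normrM ler_norml => /andP[+ _].
    by lra.
  by lra.
have hb : `|\sum_(k < n) b k * e k| <= 12 * L%:R.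
  rewrite ler_norml lerNl -sumrN.
  rewrite (eq_bigr (fun k : 'I_n => b k * (- e k))); last first.
    by move=> k _; rewrite mulrN.
  rewrite (half (fun k => - e k)) ?half //.
  - by move: hp; under eq_bigr do rewrite ce.
  - by move=> k; rewrite normrN.
  - by move: hm; under eq_bigr do rewrite ce -mulrN.
have hl : `|\sum_(k < n) (rho^-1 * a k - b k) * e k| <= 8 * L%:R.
  apply: le_trans (ler_norm_sum _ _ _) _.
  apply: le_trans (_ : \sum_(k < n) 2 * (rho^-1 * a k) ^+ 2 <= _).
    apply: ler_sum => k _; rewrite normrM e1 mulr1.
    by have [] := clip_bound (rho^-1 * a k).
  by rewrite -mulr_sumr; lra.
(* The 20 is 12 for the kept entries plus 8 for the clipped ones. *)
have hd : `|rho^-1 * \sum_(k < n) a k * chi k| <= 20 * L%:R.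
  have -> : rho^-1 * \sum_(k < n) a k * chi k =
      \sum_(k < n) b k * e k + \sum_(k < n) (rho^-1 * a k - b k) * e k.
    by rewrite mulr_sumr -big_split /=; apply: eq_bigr => k _; rewrite ce; ring.
  by apply: le_trans (ler_normD _ _) _; lra.
set d := \sum_(k < n) _ in hd *.
have : `|d| <= 20 * L%:R * rho.
  by move: hd; rewrite normrM gtr0_norm ?invr_gt0 // ler_pdivrMl // mulrC.
rewrite -[d ^+ 2]real_normK ?num_real // => h.
(* The square is [400 L (L rho ^ 2)], and [L rho ^ 2 <= sg]. *)
apply: le_trans (_ : (20 * L%:R * rho) ^+ 2 <= _).
  by rewrite ler_sqr ?nnegrE // ?(le_trans _ h).
by have : L%:R * (L%:R * rho ^+ 2) <= L%:R * sg; [rewrite ler_wpM2l|nra].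
Qed.

End Bounds.

(** * Both discrepancy bounds from the final potential *)

Section Balanced.
Variables (R : realType) (n m L : nat) (M : R).
Variables (av : nat -> nat -> R) (iv chi lam : nat -> R).
Hypotheses (mM : m%:R <= M :> R) (M2 : 2 <= M :> R) (ML : M <= 2 ^+ L).
Hypothesis iv0 : forall x, 0 <= iv x.
Hypothesis chi1 : forall k, (k < n)%N -> chi k = -1 \/ chi k = 1.
Hypothesis lamP : forall x, (x < m)%N -> scaled L (row_sq av n x) (lam x).

Let d x := \sum_(k < n) av x k * chi k.
Let p x := \prod_(k < n) (1 + clip (lam x * av x k) * chi k).
Let q x := \prod_(k < n) (1 - clip (lam x * av x k) * chi k).

Hypothesis pot : potential m av iv (total_weight n m av iv) (delta M) n d p q
  <= 2 * m%:R * delta M.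

Lemma M_gt0 : 0 < M.
Proof. exact: lt_le_trans M2. Qed.

Lemma row_sq_ge0 x : 0 <= row_sq av n x.
Proof. by apply: sumr_ge0 => k _; exact: sqr_ge0. Qed.

Lemma total_weightE : total_weight n m av iv = \sum_(x < m) iv x * row_sq av n x.
Proof.
rewrite /total_weight exchange_big; apply: eq_bigr => x _.
by rewrite /row_sq mulr_sumr.
Qed.

Lemma total_weight_ge0 : 0 <= total_weight n m av iv.
Proof.
by rewrite total_weightE sumr_ge0 // => x _; rewrite mulr_ge0 ?row_sq_ge0.
Qed.

Lemma factor_ge0 (c e : R) : e = -1 \/ e = 1 -> 0 <= 1 + clip c * e.
Proof.
have [+ _ _] := clip_bound c; rewrite ler_norml => /andP[h1 h2].
by case=> ->; lra.
Qed.

Lemma p_ge0 x : 0 <= p x.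
Proof. by apply: prodr_ge0 => k _; apply: factor_ge0; apply: chi1. Qed.

Lemma q_ge0 x : 0 <= q x.
Proof.
apply: prodr_ge0 => k _; rewrite -mulrN; apply: factor_ge0.
by case: (chi1 (ltn_ord k)) => ->; rewrite ?opprK; auto.
Qed.

Let S := total_weight n m av iv.
Let del := delta M.

Lemma delta_gt0 : 0 < del.
Proof.
have M0 := M_gt0.
by rewrite /del /delta divr_gt0 // addr_gt0 // mulr_gt0.
Qed.

Lemma deltaE : 2 * del * M ^+ 2 = 1.
Proof.
have M0 := M_gt0.
rewrite /del /delta; field.
by rewrite gt_eqF // addr_gt0 // mulr_gt0.
Qed.

(** The sum is 1 unless [S] is 0, in which case division by [S] makes it 0. *)
Lemma weighted_le1 : \sum_(x < m) iv x / S * row_sq av n x <= 1.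
Proof.
rewrite (eq_bigr (fun x : 'I_m => S^-1 * (iv x * row_sq av n x))); last first.
  by move=> x _; ring.
rewrite -mulr_sumr -total_weightE -/S.
by have [->|S0] := eqVneq S 0; rewrite ?mulr0 // mulVf.
Qed.

Lemma potential_split :
  \sum_(x < m) iv x / S * d x ^+ 2 + del * \sum_(x < m) (p x + q x)
  <= 2 * m%:R * del + \sum_(x < m) iv x / S * row_sq av n x.
Proof.
rewrite -lerBlDr; apply: le_trans pot.
rewrite /potential mulr_sumr -big_split -sumrB /=; apply: ler_sum => x _.
by rewrite -/S -/del; lra.
Qed.

Lemma weight_ratio_ge0 x : 0 <= iv x / S.
Proof. by rewrite divr_ge0 ?total_weight_ge0. Qed.

Lemma mdelta_le : 2 * m%:R * del <= M^-1.
Proof.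
have M0 := M_gt0.
rewrite -[M^-1]mul1r ler_pdivlMr // -[leRHS]deltaE.
have -> : 2 * m%:R * del * M = 2 * del * (m%:R * M) by ring.
apply: ler_wpM2l; first by rewrite mulr_ge0 // ltW // delta_gt0.
by rewrite expr2 ler_wpM2r // ltW.
Qed.

Lemma weighted_discrepancy :
  \sum_(x < m) iv x * d x ^+ 2 <= (1 + M^-1) * \sum_(x < m) iv x * row_sq av n x.
Proof.
rewrite -total_weightE -/S.
have := total_weight_ge0; rewrite -/S le_eqVlt => /orP[/eqP S0|S0].
  (* With total weight zero, each row has importance zero or only zero entries. *)
  rewrite -S0 mulr0 big1 // => x _.
  have /eqP : iv x * row_sq av n x = 0.
    move/esym/eqP: S0; rewrite /S total_weightE psumr_eq0 => [|i _].
      by move=> /allP/(_ x (mem_index_enum x))/eqP.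
    by rewrite mulr_ge0 ?row_sq_ge0.
  rewrite mulf_eq0 => /orP[/eqP->|]; first by rewrite mul0r.
  rewrite psumr_eq0 => [/allP h|i _]; last exact: sqr_ge0.
  rewrite /d big1 ?expr0n ?mulr0 // => k _.
  by move/(_ k (mem_index_enum k)): h; rewrite sqrf_eq0 => /eqP ->; rewrite mul0r.
(* Dropping the nonnegative products leaves a normalised sum of at most [1 + 1 / M]. *)
have h := potential_split; have h1 := weighted_le1; have h2 := mdelta_le.
have h3 : 0 <= del * \sum_(x < m) (p x + q x).
  by rewrite mulr_ge0 ?(ltW delta_gt0) // sumr_ge0 // => x _; rewrite addr_ge0 ?p_ge0 ?q_ge0.
have : \sum_(x < m) iv x / S * d x ^+ 2 <= 1 + M^-1 by lra.
rewrite (eq_bigr (fun x : 'I_m => S^-1 * (iv x * d x ^+ 2))); last first.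
  by move=> x _; ring.
by rewrite -mulr_sumr ler_pdivrMl // mulrC.
Qed.

(** Dropping the weighted squares and dividing by [del] gives the bound [2 m + 2 M ^ 2], which is at
    most [M ^ 4] as [m <= M] and [2 <= M]; finally [M <= 2 ^ L <= exp L]. *)
Lemma product_le x : (x < m)%N -> p x + q x <= expR (4 * L%:R).
Proof.
move=> xm; have h := potential_split; have h1 := weighted_le1.
have h3 : 0 <= \sum_(x < m) iv x / S * d x ^+ 2.
  by apply: sumr_ge0 => y _; rewrite mulr_ge0 ?sqr_ge0 ?weight_ratio_ge0.
have h2 : p x + q x <= \sum_(x < m) (p x + q x).
  rewrite (bigD1 (Ordinal xm)) //= lerDl.
  by apply: sumr_ge0 => y _; rewrite addr_ge0 ?p_ge0 ?q_ge0.
have d0 := delta_gt0; have dE := deltaE; have M2' := M2; have mM' := mM.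
have h4 : del * (p x + q x) <= del * (2 * m%:R + 2 * M ^+ 2).
  apply: le_trans (_ : del * \sum_(x < m) (p x + q x) <= _).
    by rewrite ler_wpM2l // ltW.
  by lra.
rewrite ler_pM2l // in h4; apply: (le_trans h4).
have e2 : 2 <= expR 1 :> R by apply: le_trans (expR_ge1Dx _); lra.
have Me : M <= expR L%:R.
  apply: (le_trans ML); rewrite -[L%:R]mulr1 expRM_natl.
  by rewrite lerXn2r ?nnegrE ?expR_ge0.
apply: le_trans (_ : M ^+ 4 <= _).
  have -> : M ^+ 4 = M ^+ 2 * M ^+ 2 by rewrite -exprD.
  have : 2 * M <= M ^+ 2 by nra.
  by nra.
by rewrite expRM_natl lerXn2r ?nnegrE ?expR_ge0 //; lra.
Qed.

Lemma all_discrepancies x : (x < m)%N -> d x ^+ 2 <= 400 * L%:R * row_sq av n x.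
Proof.
move=> xm; have [rho [lE r0 h1 h2]] := lamP xm; have h := product_le xm.
have p0 := p_ge0 x; have q0 := q_ge0 x.
apply: (@row_discrepancy _ n L (av x) chi rho) => //; rewrite -lE.
- by apply: le_trans h; rewrite lerDl.
- by apply: le_trans h; rewrite lerDr.
Qed.

End Balanced.

(** * Compressed sparse columns *)

Lemma nth_flatten_take (T : Type) (x0 : T) (ss : seq (seq T)) j i :
  (j < size ss)%N -> (i < size (nth [::] ss j))%N ->
  nth x0 (flatten ss) (sumn (take j (shape ss)) + i) = nth x0 (nth [::] ss j) i.
Proof.
elim: ss j => // s ss IH [|j] /=; first by move=> _ h; rewrite nth_cat h.
rewrite ltnS => js h; rewrite nth_cat -addnA ltnNge leq_addr /= addKn.
exact: IH.
Qed.

Section Csc.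
Variables (R : realType) (m n : nat) (A : 'M[R]_(m, n)).

(** Padding with zeros lets the matrix be indexed by the integers of the machine. *)
Definition entry (x j : nat) : R :=
  oapp (fun i => oapp (A i) 0 (insub j)) 0 (insub x).

Lemma entryE (i : 'I_m) (j : 'I_n) : entry i j = A i j.
Proof. by rewrite /entry !valK. Qed.

Lemma entry_out x j : (m <= x)%N -> entry x j = 0.
Proof.
move=> mx; rewrite /entry (_ : insub x = None :> option 'I_m) //.
by apply: insubF; rewrite ltnNge mx.
Qed.

Lemma support_rows_entry (j : 'I_n) :
  support_rows m entry j = [seq val i | i <- col_rows A j].
Proof.
rewrite /support_rows -val_enum_ord filter_map; congr map; apply: eq_filter => i /=.
by rewrite entryE.
Qed.

Lemma size_support_rows_entry (j : 'I_n) : size (support_rows m entry j) = size (col_rows A j).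
Proof. by rewrite support_rows_entry size_map. Qed.

Lemma csc_ptr0 : csc_ptr A 0 = 0%N.
Proof. by rewrite /csc_ptr big_pred0. Qed.

Lemma csc_ptrS j : (j < n)%N ->
  csc_ptr A j.+1 = (csc_ptr A j + size (support_rows m entry j))%N.
Proof.
move=> jn; rewrite (size_support_rows_entry (Ordinal jn)) /csc_ptr.
rewrite (bigD1 (Ordinal jn)) //= addnC; congr addn; apply: eq_bigl => k.
by rewrite -val_eqE /= ltnS ltn_neqAle andbC.
Qed.

(** The offset of a column does not depend on what is stored per entry, so an arbitrary [f] covers
    row numbers and values at once. *)
Lemma csc_ptr_take (T : Type) (f : 'I_m -> 'I_n -> T) j : (j <= n)%N ->
  csc_ptr A j =
  sumn (take j (shape [seq [seq f i k | i <- col_rows A k] | k <- enum 'I_n])).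
Proof.
elim: j => [|j IH] jn; first by rewrite take0 csc_ptr0.
have sz : size (shape [seq [seq f i k | i <- col_rows A k] | k <- enum 'I_n]) = n.
  by rewrite 2!size_map size_enum_ord.
rewrite (take_nth 0%N) ?sz // sumn_rcons csc_ptrS // IH ?(ltnW jn) //; congr addn.
rewrite /shape -map_comp (nth_map (Ordinal jn)) ?size_enum_ord //=.
by rewrite size_map -(size_support_rows_entry) (nth_enum_ord _ jn).
Qed.

Lemma csc_nth (T : Type) (x0 : T) (f : 'I_m -> 'I_n -> T) (j : 'I_n) i :
  (i < size (col_rows A j))%N ->
  nth x0 (flatten [seq [seq f i k | i <- col_rows A k] | k <- enum 'I_n])
    (csc_ptr A j + i) = nth x0 [seq f i j | i <- col_rows A j] i.
Proof.
move=> isz; rewrite (csc_ptr_take f) ?(ltnW (ltn_ord j)) //.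
have nj : nth [::] [seq [seq f i k | i <- col_rows A k] | k <- enum 'I_n] j
    = [seq f i j | i <- col_rows A j].
  by rewrite (nth_map j) ?size_enum_ord // nth_ord_enum.
by rewrite -nj nth_flatten_take ?nj // size_map ?size_enum_ord.
Qed.

Lemma csc_rowE j i : (j < n)%N -> (i < size (support_rows m entry j))%N ->
  nth 0%N (csc_row A) (csc_ptr A j + i) = nth 0%N (support_rows m entry j) i.
Proof.
move=> jn; rewrite -[j]/(val (Ordinal jn)) size_support_rows_entry => isz.
by rewrite /csc_row (csc_nth 0%N (fun i _ => val i) isz) support_rows_entry.
Qed.

Lemma csc_valE j i : (j < n)%N -> (i < size (support_rows m entry j))%N ->
  nth 0 (csc_val A) (csc_ptr A j + i) = entry (nth 0%N (support_rows m entry j) i) j.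
Proof.
move=> jn; rewrite -[j]/(val (Ordinal jn)) size_support_rows_entry => isz.
rewrite /csc_val (csc_nth 0 (fun i j => A i j) isz) support_rows_entry.
have i0 : 'I_m by case: (col_rows A (Ordinal jn)) isz.
by rewrite !(nth_map i0) // entryE.
Qed.

Lemma nnzE : nnz A = (\sum_(j < n) size (support_rows m entry j))%N.
Proof.
rewrite /nnz -sum1_card.
rewrite -(pair_big_dep xpredT (fun i j => A i j != 0) (fun _ _ => 1%N)) /=.
rewrite (exchange_big_dep xpredT) //=; apply: eq_bigr => j _.
by rewrite size_support_rows_entry size_filter -sum1_count big_enum_cond.
Qed.

End Csc.

(** * The running time *)

Section Logarithms.
Variable R : realType.

(** It rests on [exp (1/2) <= 2], which follows from [exp (-1/2) >= 1 - 1/2]. *)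
Lemma pow2_ln (k : nat) (M : R) : 2 ^+ k <= M -> k%:R <= 2 * ln M.
Proof.
move=> kM; have M0 : 0 < M by apply: lt_le_trans kM; rewrite exprn_gt0.
have h : expR (2^-1) <= 2 :> R.
  rewrite -[2^-1]opprK expRN -[leRHS]invrK lef_pV2 ?posrE ?expR_gt0 ?invr_gt0 //.
  by apply: le_trans (expR_ge1Dx _); lra.
rewrite mulrC -ler_pdivrMr // -ler_expR lnK ?posrE //; apply: le_trans kM.
by rewrite expRM_natl lerXn2r ?nnegrE ?expR_ge0.
Qed.

(** Minimality gives [2 ^ (L - 1) < M], so [L - 1 <= 2 ln M]; the remaining 1 is also at most
    [2 ln M], because [2 <= M]. *)
Lemma exists_log2 (M : R) : 2 <= M -> exists L : nat,
  [/\ (0 < L)%N, M <= 2 ^+ L, forall l, M <= 2 ^+ l -> (L <= l)%N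
    & L%:R <= 4 * ln M].
Proof.
move=> M2; have ex : exists l, M <= 2 ^+ l.
  exists (Num.Def.archi_bound M).
  rewrite (le_trans (ltW (archi_boundP _))) //; first by lra.
  by rewrite -natrX ler_nat ltnW // ltn_expl.
case: (ex_minnP ex) => -[|L] ML Lmin; first by move: ML; rewrite expr0; lra.
exists L.+1; split=> //.
have h1 : 1%:R <= 2 * ln M by apply: pow2_ln; rewrite expr1.
have h2 : L%:R <= 2 * ln M.
  apply: pow2_ln; rewrite leNgt; apply/negP => /ltW /Lmin.
  by rewrite ltnn.
by rewrite -natr1; lra.
Qed.

Lemma up_log_ln (n : nat) (Y : R) : 1 <= Y -> n%:R <= Y ->
  (up_log 2 n)%:R <= 1 + 2 * ln Y.
Proof.
move=> Y1 nY; have l0 : 0 <= ln Y by exact: ln_ge0.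
have [n1|n1] := leqP n 1.
  by rewrite (_ : up_log 2 n = 0%N); [lra | move: n n1 {nY} => [|[|]]].
have /andP[h _] := up_log_bounds (isT : 1 < 2)%N n1.
have : (up_log 2 n).-1%:R <= 2 * ln Y.
  apply: pow2_ln; apply: le_trans nY.
  by rewrite -natrX ler_nat ltnW.
have : (up_log 2 n)%:R <= 1 + (up_log 2 n).-1%:R :> R.
  by rewrite addrC natr1 ler_nat leqSpred.
by lra.
Qed.

(** Uses [N + 1 <= 2 max(N, 1)] and [2 L + l + 1 <= 10 Y + 2]. *)
Lemma work_bound (c w N L l : nat) (Y : R) :
  (w <= c * N.+1 * (L + (L + l)).+1)%N -> L%:R <= 4 * Y -> l%:R <= 1 + 2 * Y ->
  w%:R <= (maxn N 1)%:R * (c%:R * (20 * Y + 4)).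
Proof.
move=> hw hL hl.
apply: le_trans (_ : (maxn N 1 * (c * (2 * (2 * L + l + 1))))%:R <= _).
  rewrite ler_nat (leq_trans hw) // -mulnA [leqRHS]mulnCA leq_mul2l.
  rewrite mulnCA mulnA (_ : (L + (L + l)).+1 = 2 * L + l + 1)%N; last by lia.
  by rewrite leq_mul2r (_ : N.+1 <= _)%N ?orbT //; lia.
rewrite natrM; apply: ler_wpM2l; first exact: ler0n.
rewrite natrM; apply: ler_wpM2l; first exact: ler0n.
rewrite (natrM _ 2) (natrD _ (2 * L + l)) (natrD _ (2 * L)) (natrM _ 2 L).
by lra.
Qed.

(** The logarithm [l] of [n] need not be polylogarithmic in [M]; being at most [n], it is absorbed
    by the factor [max(n, 1)]. *)
Lemma depth_bound (c w n L l : nat) (Y : R) :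
  (w <= c * n.+1 * L.+1 + 4 * (L + l))%N -> L%:R <= 4 * Y -> (l <= n)%N ->
  w%:R <= (maxn n 1)%:R * (c%:R * (8 * Y + 2) + (16 * Y + 4)).
Proof.
move=> hw hL hl; set x := maxn n 1.
have h1 : (n.+1 <= x * 2)%N by rewrite /x; lia.
have h3 : (L <= x * L)%N by rewrite leq_pmull // /x; lia.
apply: le_trans (_ : (x * (c * (2 * (L + 1))) + x * (4 * (L + 1)))%:R <= _).
  rewrite ler_nat (leq_trans hw) //; apply: leq_add.
    by rewrite -mulnA [leqRHS]mulnCA leq_mul2l mulnA addn1 leq_mul2r h1 !orbT.
  rewrite mulnCA leq_mul2l mulnDr muln1; apply: leq_add => //.
  by rewrite /x; lia.
have -> : (x * (c * (2 * (L + 1))) + x * (4 * (L + 1)))%:R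
    = x%:R * (c%:R * (2 * (L%:R + 1))) + x%:R * (4 * (L%:R + 1)) :> R.
  by rewrite natrD !natrM (natrD _ L).
rewrite [leRHS]mulrDr; apply: lerD.
  apply: ler_wpM2l; first exact: ler0n.
  by apply: ler_wpM2l; [exact: ler0n | lra].
by apply: ler_wpM2l; [exact: ler0n | lra].
Qed.

End Logarithms.

Theorem theorem3p2 (R : realType) :
  exists C : R, 0 < C /\
  exists (P : cmd) (p q : {poly R}),
  forall (n m : nat) (M : R) (A : 'M[R]_(m, n)) (imp : 'I_m -> R),
    Num.max m%:R 2 <= M ->
    (forall i, 0 <= imp i) ->
    exists (s : state R) (k : cost),
      [/\ exec P (input M A imp) s k,
          (work k)%:R <=
            (maxn (nnz A + n + m) 1)%:R * p.[ln (n%:R + m%:R + M)],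
          (depth k)%:R <= (maxn n 1)%:R * q.[ln M]
        & let chi := output s in
          [/\ forall j : 'I_n, chi j = -1 \/ chi j = 1,
              \sum_(i < m) imp i * disc A chi i ^+ 2 <=
                (1 + M^-1) * \sum_(i < m) imp i * \sum_(j < n) A i j ^+ 2
            & forall i : 'I_m,
                disc A chi i ^+ 2 <= C * ln M * \sum_(j < n) A i j ^+ 2]].
Proof.
(* The 400 comes from [all_discrepancies] and the 4 from [L <= 4 ln M]; the polynomials are those of
   [work_bound] and [depth_bound] with [c = 200]. *)
exists (400 * 4); split; first by rewrite mulr_gt0 ?ltr0n.
exists balance, (200%:R%:P * (20%:P * 'X + 4%:P)),
  (200%:R%:P * (8%:P * 'X + 2%:P) + (16%:P * 'X + 4%:P)).
move=> n m M A imp; rewrite ge_max => /andP[mM M2] imp0.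
have [L [L0 ML Lmin LM]] := exists_log2 M2.
pose av := entry A; pose iv k : R := oapp imp 0 (insub k).
have iv0 x : 0 <= iv x by rewrite /iv; case: insubP => /=.
have ivE (i : 'I_m) : iv i = imp i by rewrite /iv valK.
have sqE (i : 'I_m) : row_sq av n i = \sum_(j < n) A i j ^+ 2.
  by apply: eq_bigr => j _; rewrite /av entryE.
(* [K] halvings suffice for every row: [L * n <= 2 ^ L * 2 ^ l = 2 ^ K <= 4 ^ K]. *)
pose l := up_log 2 n; pose K := (L + l)%N.
have mL : (m <= 2 ^ L)%N by rewrite -(ler_nat R) natrX (le_trans mM).
have n2l : (n <= 2 ^ l)%N by have := @up_logP 2 n isT.
have sqab x : row_sq av n x <= row_abs av n x ^+ 2 by exact: sum_sq_le_abs.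
have abK x : L%:R * row_abs av n x ^+ 2 <= 4 ^+ K * row_sq av n x.
  have s0 : 0 <= row_sq av n x by apply: sumr_ge0 => k _; exact: sqr_ge0.
  apply: le_trans (_ : L%:R * (n%:R * row_sq av n x) <= _).
    by rewrite ler_wpM2l // abs_le_sum_sq.
  rewrite mulrA ler_wpM2r // -natrM -natrX ler_nat.
  apply: leq_trans (_ : 2 ^ K <= _)%N; last by rewrite leq_exp2r // /K addn_gt0 L0.
  by rewrite /K expnD leq_mul // ltnW // ltn_expl.
have sz0 a : a \in [:: 3; 4; 7]%N -> rmem (input M A imp) a = fun=> 0.
  by rewrite !inE => /or3P[] /eqP ->.
have [s [k [e hw hd _ [lam [sinv lamP]]]]] := @runs_balance R n m M av iv
  (csc_ptr A) (nth 0%N (csc_row A)) (nth 0 (csc_val A)) (@entry_out _ _ _ A)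
  (@csc_ptrS _ _ _ A) (@csc_rowE _ _ _ A) (@csc_valE _ _ _ A) L K
  (input M A imp) L0 ML Lmin mL sqab abK erefl erefl erefl erefl erefl erefl
  erefl sz0.
case: sinv => _ _ _ _ _ chi1 sd sp sq_ spot.
pose chi := rmem s 2.
have d2 (i : 'I_m) : disc A (output s) i ^+ 2 =
    (\sum_(j < n) av i j * chi j) ^+ 2.
  rewrite /disc real_normK ?num_real //; congr (_ ^+ 2).
  by apply: eq_bigr => j _; rewrite /av entryE.
have pot : potential m av iv (total_weight n m av iv) (delta M) n
    (fun x => \sum_(j < n) av x j * chi j)
    (fun x => \prod_(j < n) (1 + clip (lam x * av x j) * chi j))
    (fun x => \prod_(j < n) (1 - clip (lam x * av x j) * chi j))
    <= 2 * m%:R * delta M.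
  apply: le_trans spot; rewrite le_eqVlt; apply/orP; left; apply/eqP.
  by apply: eq_bigr => x _; rewrite sd // sp // sq_.
exists s, k; split=> //.
- have Y1 : 1 <= n%:R + m%:R + M by have := ler0n R n; have := ler0n R m; lra.
  have YM : ln M <= ln (n%:R + m%:R + M).
    rewrite ler_ln ?posrE; [|lra..].
    by have := ler0n R n; have := ler0n R m; lra.
  have lY : l%:R <= 1 + 2 * ln (n%:R + m%:R + M).
    by apply: up_log_ln => //; have := ler0n R m; lra.
  rewrite -nnzE in hw; rewrite !(hornerM, hornerD, hornerC, hornerX).
  apply: work_bound hw _ lY.
  by rewrite (le_trans LM) // ler_wpM2l.
- rewrite !(hornerM, hornerD, hornerC, hornerX); apply: depth_bound hd LM _.
  by apply: up_log_min => //; rewrite ltnW // ltn_expl.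
split.
- by move=> j; exact: chi1.
- have := @weighted_discrepancy R n m M av iv chi lam mM M2 iv0 chi1 pot.
  rewrite [X in X <= _ -> _](eq_bigr (fun i : 'I_m => imp i * disc A (output s) i ^+ 2)).
    rewrite [X in _ <= _ * X -> _](eq_bigr (fun i : 'I_m => imp i * \sum_(j < n) A i j ^+ 2)) //.
    by move=> i _; rewrite ivE sqE.
  by move=> i _; rewrite ivE d2.
- move=> i; rewrite d2 -sqE.
  apply: le_trans (@all_discrepancies R n m L M av iv chi lam mM M2 ML iv0 chi1
    lamP pot i (ltn_ord i)) _.
  have s0 : 0 <= row_sq av n i by apply: sumr_ge0 => j _; exact: sqr_ge0.
  by rewrite ler_wpM2r // -[400 * 4 * _]mulrA ler_wpM2l.
Qed.
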